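(* Let $A$ be a strictly generic non-commutative algebra of type $(n,r)$ over a field $k$. Then $A$ is Koszul if and only if $r\le n^2/4$ or $r\ge 3n^2/4$.
   Context: A non-commutative algebra of type $(n,r)$ over $k$ is a graded algebra $A=k\langle x_1,\ldots,x_n\rangle/(f_1,\ldots,f_r)$, where $f_1,\ldots,f_r$ are linearly independent quadratic forms in the free associative algebra ($\deg x_i=1$, $n\ge1$, $0\le r\le n^2$). It is strictly generic if it has such a presentation in which all $rn^2$ coefficients of $f_1,\ldots,f_r$ with respect to the $n^2$ monomials $x_ix_j$ are algebraically independent over the prime field of $k$. $A$ is Koszul if $\mathrm{Tor}^A_{i}(k,k)$ is concentrated in internal degree $i$ for all $i$. *)

(* Defs.v *)
From HB Require Import structures.
From mathcomp Require Import all_boot all_order all_algebra.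
From mathcomp Require Import finmap.
From mathcomp Require Import mpoly monalg.

Set Implicit Arguments.
Unset Strict Implicit.
Unset Printing Implicit Defensive.

Import GRing.Theory.
Local Open Scope ring_scope.

(* The prime field of [k] is the intersection of all subfields of [k]. *)
Definition in_prime_field (k : fieldType) (x : k) : Prop :=
  forall S : {pred k}, divring_closed S -> x \in S.

(* [enum_val] enumerates the finite index type [I], so the variables of the
   polynomials are indexed by [I]. *)
Definition alg_independent_over_prime_field
    (k : fieldType) (I : finType) (v : I -> k) : Prop :=
  forall p : mpoly.mpoly #|I| k,
    (forall m, in_prime_field (mpoly.mcoeff m p)) ->
    mpoly.meval (fun i => v (enum_val i)) p = 0 -> p = 0.

(* Connected non-negatively graded algebras (those with degree 0 part [k]):
   [cg_hom A m] is the component A_m.  The augmentation A -> k, which makes [k]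
   an A-bimodule, is determined by the other fields. *)
Record cg_algebra (k : fieldType) := CGAlgebra {
  cg_alg :> algType k;
  cg_hom : nat -> cg_alg -> Prop;
  cg_hom0 : forall m, cg_hom m 0;
  cg_homP : forall m (c : k) a b,
    cg_hom m a -> cg_hom m b -> cg_hom m (c *: a + b);
  cg_hom1 : cg_hom 0 1;
  cg_homM : forall i j a b,
    cg_hom i a -> cg_hom j b -> cg_hom (i + j) (a * b);
  cg_span : forall a, exists (N : nat) (c : nat -> cg_alg),
    (forall m, cg_hom m (c m)) /\ a = \sum_(m < N) c m;
  cg_direct : forall (N : nat) (c : nat -> cg_alg),
    (forall m, cg_hom m (c m)) -> \sum_(m < N) c m = 0 ->
    forall m, (m < N)%N -> c m = 0;
  cg_connected : forall a, cg_hom 0 a -> exists c : k, a = c%:A;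
  cg_aug : {lrmorphism cg_alg -> k^o};
  cg_aug_pos : forall m a, (0 < m)%N -> cg_hom m a -> cg_aug a = 0
}.

(* The free associative algebra k<x_1, ..., x_n>: the algebra of the free
   monoid on 'I_n. *)
Definition free_algebra (k : fieldType) (n : nat) :=
  {malg k[{fmonom 'I_n}]}.

Definition free_homog (k : fieldType) (n m : nat) (g : free_algebra k n) :=
  forall w, w \in msupp g -> fdeg w = m.

Definition in_ideal (k : fieldType) (n r : nat)
    (f : 'I_r -> free_algebra k n) (g : free_algebra k n) : Prop :=
  exists (N : nat) (a b : 'I_N -> free_algebra k n) (s : 'I_N -> 'I_r),
    g = \sum_(t < N) a t * f (s t) * b t.

(* [A] is, as a graded algebra, k<x_1, ..., x_n>/(f_1, ..., f_r). *)
Definition presented_by (k : fieldType) (n r : nat) (A : cg_algebra k)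
    (f : 'I_r -> free_algebra k n) : Prop :=
  exists pi : {lrmorphism free_algebra k n -> A},
  [/\ forall a : A, exists g, pi g = a,
      forall m g, free_homog m g -> cg_hom m (pi g)
    & forall g, pi g = 0 <-> in_ideal f g].

Definition quadratic_presentation (k : fieldType) (n r : nat)
    (A : cg_algebra k) (f : 'I_r -> free_algebra k n) : Prop :=
  [/\ forall s, free_homog 2 (f s),
      forall c : 'I_r -> k, \sum_(s < r) c s *: f s = 0 -> forall s, c s = 0
    & presented_by A f].

Definition strictly_generic (k : fieldType) (n r : nat)
    (A : cg_algebra k) : Prop :=
  exists f : 'I_r -> free_algebra k n,
    quadratic_presentation A f /\
    alg_independent_over_prime_field
      (fun t : 'I_r * 'I_n * 'I_n =>
         mcoeff (mmul (fmu t.1.2) (fmu t.2)) (f t.1.1)).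

(* {malg A[G]} is the free left A-module with basis G; [deg] gives the degrees
   of the basis elements. *)
Definition free_mod_homog (k : fieldType) (A : cg_algebra k) (G : choiceType)
    (deg : G -> nat) (j : nat) (p : {malg A[G]}) : Prop :=
  forall g, if (deg g <= j)%N then cg_hom (j - deg g) (mcoeff g p) else mcoeff g p = 0.

(* A_+ P for P = {malg A[G]}, i.e. the kernel of P -> k (x)_A P. *)
Definition in_aug_submod (k : fieldType) (A : cg_algebra k) (G : choiceType)
    (p : {malg A[G]}) : Prop :=
  forall g, cg_aug A (mcoeff g p) = 0.

(* Resolutions ... -> P_1 -> P_0 -> k -> 0 of the left A-module [k] by graded
   free left A-modules P_i = {malg A[res_gen i]}, with differentials and
   augmentation homogeneous of degree 0. *)
Record graded_free_resolution (k : fieldType) (A : cg_algebra k) :=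
    GradedFreeResolution {
  res_gen : nat -> choiceType;
  res_deg : forall i, res_gen i -> nat;
  res_diff : forall i, {linear {malg A[res_gen i.+1]} -> {malg A[res_gen i]}};
  res_aug : {additive {malg A[res_gen 0]} -> k};
  res_diff_homog : forall i j p,
    free_mod_homog (@res_deg i.+1) j p ->
    free_mod_homog (@res_deg i) j (res_diff i p);
  res_aug_homog : forall j p,
    (0 < j)%N -> free_mod_homog (@res_deg 0) j p -> res_aug p = 0;
  res_augZ : forall (a : A) p, res_aug (a *: p) = cg_aug A a * res_aug p;
  res_aug_surj : forall c : k, exists p, res_aug p = c;
  res_exact0 : forall p, res_aug p = 0 <-> exists q, p = res_diff 0 q;
  res_exact : forall i p,
    res_diff i p = 0 <-> exists q, p = res_diff i.+1 q
}.

Definition tor_cycle (k : fieldType) (A : cg_algebra k)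
    (P : graded_free_resolution A) (i : nat) :
    {malg A[res_gen P i]} -> Prop :=
  match i with
  | 0 => fun _ => True
  | i'.+1 => fun p => in_aug_submod (res_diff P i' p)
  end.

(* Tor^A_i(k,k)_j, the degree j part of the i-th homology of k (x)_A P, is zero.
   Since k (x)_A P_i = P_i / A_+ P_i, elements, cycles and boundaries are
   expressed through representatives in P_i.  Tor does not depend on the
   resolution P; all graded free resolutions are considered, rather than a
   chosen one. *)
Definition tor_vanishes (k : fieldType) (A : cg_algebra k) (i j : nat) : Prop :=
  forall (P : graded_free_resolution A) (p : {malg A[res_gen P i]}),
    free_mod_homog (@res_deg _ _ P i) j p -> tor_cycle p ->
    exists2 q, free_mod_homog (@res_deg _ _ P i.+1) j q
             & in_aug_submod (p - res_diff P i q).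

Definition koszul (k : fieldType) (A : cg_algebra k) : Prop :=
  forall i j : nat, i != j -> tor_vanishes A i j.

(* Main.v *)
Require Import Defs.
From HB Require Import structures.
From mathcomp Require Import all_boot all_order all_algebra.
From mathcomp Require mpoly.
From mathcomp Require Import boolp finmap monalg.
From mathcomp Require Import ring zify.

(**
Write V for the span of the generators and R for the space of relations.

For relations Q in V (x) V let U_m be the orthogonal in V^m of the degree m part
of the ideal (Q).  The sequence 0 -> U_(m+2) -> V (x) U_(m+1) -> Q^* (x) U_m is
exact, so u_m = dim U_m satisfies u_(m+2) >= n u_(m+1) - q u_m, with equality
for all m iff the last map is always surjective; this in turn forces
n^2 >= 4q, because a solution of the recurrence of negative discriminant
changes sign.  The numbers u_m are upper semicontinuous, hence surjectivity for
generic Q follows from surjectivity for one special Q over the prime field: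
monomials ab with a and b in disjoint sets of letters if 4q <= n^2 (all m), and
U (x) U (x) <xy, x^2 + y^2> on the generators U (x) <x, y>, with a modification
for odd n, if 2q <= n^2 (m = 1).  The same applies to the orthogonal of generic
relations.

A is Koszul iff its right Koszul complex W_a (x) A, where W_a is the
intersection of the V^i R V^(a-2-i), is exact: this is a diagram chase in the
double complex W_a (x) P_b for a graded free resolution P.  If U_3(R) has the
expected dimension, then W_3 = 0 and exactness amounts to injectivity of
R (x) A -> V (x) A, which is dual to the surjectivity above for Q = R.  If the
orthogonal of R has this property, then A_3 = 0, the space W_a is U_a for Q the
orthogonal of R, and exactness is again the surjectivity above.
*)

Set Implicit Arguments.
Unset Strict Implicit.
Unset Printing Implicit Defensive.

Import GRing.Theory.
Local Open Scope ring_scope.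

(** * Words and relation spaces *)

(** The hard direction is to refute Koszulness for every r strictly between n^2/4 and 3n^2/4. There
    the Koszul complex must be shown to be short, through W_3 = 0 or A_3 = 0. Both are degree 3
    statements, which is why m = 1 is treated up to n^2/2 relations: one of R and its orthogonal is
    always in that range. Monomials in disjoint letters stop at n^2/4, so other special relations
    have to be found; the explicit ones have coefficients 0, 1 and -1 and work in every
    characteristic. The coefficients of the orthogonal of R are not independent variables. They are
    reached through a spanning family of the orthogonal that is polynomial in the coefficients of R
    and keeps spanning it at the chosen special point. Koszulness is a condition on all graded free
    resolutions, so using it as a hypothesis requires one resolution to exist. The one constructed
    is far from minimal, and the extraction of exactness has to cope with generators of P_1 in
    degree 0. *)

Lemma sum_pair (I T : finType) (V : nmodType) (F : I * T -> V) :
  \sum_p F p = \sum_i \sum_t F (i, t).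
Proof. by rewrite pair_bigA /=; apply: eq_bigr => -[]. Qed.

Lemma sum_pick (T : finType) (V : nmodType) (t0 : T) (F : T -> V) :
  \sum_t (if t0 == t then F t else 0) = F t0.
Proof. by rewrite -big_mkcond (big_pred1 t0) // => t; rewrite /= eq_sym. Qed.

Section Words.
Variable X : finType.

Fixpoint word m : finType := if m is m'.+1 then (X * word m')%type else unit.

Lemma sum_word (V : nmodType) m (F : word m.+1 -> V) :
  \sum_w F w = \sum_x \sum_(w : word m) F (x, w).
Proof. exact: sum_pair. Qed.

Lemma sum_word0 (V : nmodType) (F : word 0 -> V) : \sum_w F w = F tt.
Proof. by rewrite (big_pred1 tt) // => -[]. Qed.

Definition slice V m (z : word m.+1 -> V) x : word m -> V := fun w => z (x, w).

Variable J : finType.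

(** Indexes Q V^(m-1), the relations placed on the first two letters of words of length m+1; there
    are none for m = 0. *)
Definition headrel m : finType :=
  if m is m'.+1 then (J * word m')%type else void.

Fixpoint relgen m : finType :=
  if m is m'.+1 then (X * relgen m' + headrel m')%type else void.

Section Coef.
Variable S : nzRingType.
Implicit Type Q : J -> X -> X -> S.

Definition headcoef Q m : headrel m -> word m.+1 -> S :=
  match m with
  | 0 => fun _ _ => 0
  | m'.+1 => fun r w => if r.2 == w.2.2 then Q r.1 w.1 w.2.1 else 0
  end.

(* The spanning set of the degree m part of the ideal (Q) of the free algebra
   obtained from I_(m+1) = V I_m + Q V^(m-1). *)
Fixpoint relcoef Q m : relgen m -> word m -> S :=
  match m with
  | 0 => fun _ _ => 0
  | m'.+1 => fun g w =>
      match g with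
      | inl p => if p.1 == w.1 then relcoef Q p.2 w.2 else 0
      | inr r => headcoef Q r w
      end
  end.

(* The orthogonal of I_m, with coefficients in M. *)
Definition inU (M : lmodType S) Q m (z : word m -> M) : Prop :=
  forall g : relgen m, \sum_w relcoef Q g w *: z w = 0.

Variable M : lmodType S.
Implicit Types (m : nat).

Lemma sum_inl Q m (z : word m.+1 -> M) x (g : relgen m) :
  \sum_w relcoef Q (m := m.+1) (inl (x, g)) w *: z w
  = \sum_w relcoef Q g w *: z (x, w).
Proof.
rewrite sum_word /=.
rewrite (eq_bigr (fun y => if x == y then \sum_w relcoef Q g w *: z (y, w) else 0)).
  by rewrite sum_pick.
by move=> y _; case: eqP => // _; rewrite big1 // => w _; rewrite scale0r.
Qed.

Lemma sum_inr Q m (z : word m.+2 -> M) j (u : word m) :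
  \sum_w relcoef Q (m := m.+2) (inr (j, u)) w *: z w
  = \sum_x \sum_y Q j x y *: z (x, (y, u)).
Proof.
rewrite sum_word /=; apply: eq_bigr => x _.
rewrite sum_word /=; apply: eq_bigr => y _.
rewrite -[RHS](sum_pick u (fun u => Q j x y *: z (x, (y, u)))).
by apply: eq_bigr => w _; case: eqP => // _; rewrite scale0r.
Qed.

Lemma inU_slice Q m (z : word m.+1 -> M) x :
  inU Q z -> inU Q (slice z x).
Proof. by move=> h g; rewrite -(sum_inl Q z) h. Qed.

Lemma inU0 Q (z : word 0 -> M) : inU Q z. Proof. by case. Qed.

Lemma inU1 Q (z : word 1 -> M) : inU Q z. Proof. by do 2!case. Qed.

(** This makes U_(m+2) the kernel of a map on V (x) U_(m+1), so that membership can be checked by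
    recursion on the length. *)
Lemma inUSS Q m (z : word m.+2 -> M) :
  inU Q z <-> (forall x, inU Q (slice z x))
    /\ (forall j u, \sum_x \sum_y Q j x y *: z (x, (y, u)) = 0).
Proof.
split=> [h|[h1 h2]].
  by split=> [x|j u]; [apply: inU_slice | rewrite -sum_inr h].
by case=> [[x g]|[j u]]; rewrite ?sum_inl ?sum_inr ?h2 //; apply: h1.
Qed.

Lemma inU_sum Q m (I : Type) (r : seq I) (z : I -> word m -> M) :
  (forall i, inU Q (z i)) -> inU Q (fun w => \sum_(i <- r) z i w).
Proof.
move=> h g; under eq_bigr do rewrite scaler_sumr.
by rewrite exchange_big big1 // => i _; apply: h.
Qed.

Lemma inU_ext Q m (z z' : word m -> M) : z =1 z' -> inU Q z -> inU Q z'.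
Proof. by move=> e h g; rewrite -[RHS](h g); apply: eq_bigr => w _; rewrite e. Qed.

Lemma inU_const0 Q m : inU Q (fun _ : word m => 0 : M).
Proof. by move=> g; rewrite big1 // => w _; rewrite scaler0. Qed.

Lemma inU_sub Q m (z z' : word m -> M) :
  inU Q z -> inU Q z' -> inU Q (fun w => z w - z' w).
Proof.
move=> h h' g; under eq_bigr do rewrite scalerBr.
by rewrite sumrB h h' subrr.
Qed.

End Coef.

Lemma inU_scale (S : comNzRingType) (M : lmodType S) (Q : J -> X -> X -> S) m
    (a : S) (z : word m -> M) :
  inU Q z -> inU Q (fun w => a *: z w).
Proof.
move=> h g; transitivity (a *: \sum_w relcoef Q g w *: z w); last by rewrite h scaler0.
rewrite scaler_sumr; by apply: eq_bigr => w _; rewrite !scalerA mulrC.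
Qed.

(** Base change: it serves both the specialization of coefficients and the passage from k to A. *)
Lemma relcoef_morph (S S' : nzRingType) (phi : {rmorphism S -> S'})
    (Q : J -> X -> X -> S) m (g : relgen m) (w : word m) :
  relcoef (fun j x y => phi (Q j x y)) g w = phi (relcoef Q g w).
Proof.
elim: m g w => [|m IH] /= g w; first by rewrite rmorph0.
case: g => [[x g]|r] /=; first by case: ifP; rewrite ?rmorph0 ?IH.
by case: m r w {IH} => [[]|m] // r w /=; case: ifP; rewrite ?rmorph0.
Qed.

End Words.

(** * Linear algebra in spaces of functions on a finite type *)

Section Vect.
Variable k : fieldType.

(** Some coordinate of the component of [z] along a complement of [U] is nonzero; this coordinate,
    composed with the projection, is the functional. *)
Lemma separating_functional (T : finType) (U : {vspace {ffun T -> k^o}}) z :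
  z \notin U -> exists l : T -> k,
    (forall u, u \in U -> \sum_t l t * u t = 0) /\ \sum_t l t * z t != 0.
Proof.
move=> zU; pose p := (\1 - projv U)%VF.
have [t0 nz] : exists t, p z t != 0.
  apply/existsP; apply: contraR zU => /existsPn h.
  have /eqP : p z = 0 by apply/ffunP=> t; rewrite ffunE; apply/eqP/negbNE/h.
  by rewrite /p add_lfunE opp_lfunE id_lfunE subr_eq0 => /eqP ->; apply: memv_proj.
pose d t : {ffun T -> k^o} := [ffun s => (s == t)%:R].
have E (u : {ffun T -> k^o}) : \sum_t p (d t) t0 * u t = p u t0.
  have -> : u = \sum_t u t *: d t.
    apply/ffunP=> s; rewrite sum_ffunE (bigD1 s) //= !ffunE eqxx.
    rewrite big1 ?addr0 ?[_ *: _]mulr1 // => t ts.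
    by rewrite !ffunE eq_sym (negbTE ts) scaler0.
  rewrite linear_sum sum_ffunE; apply: eq_bigr => t _.
  rewrite linearZ ffunE [RHS]mulrC; congr (_ * _).
  rewrite sum_ffunE (bigD1 t) //= !ffunE eqxx.
  rewrite big1 ?addr0 ?[_ *: _]mulr1 // => s ts.
  by rewrite !ffunE eq_sym (negbTE ts) scaler0.
exists (fun t => p (d t) t0); split; last by rewrite E.
move=> u uU; rewrite E /p add_lfunE opp_lfunE id_lfunE projv_id // subrr.
by rewrite ffunE.
Qed.

(** Turns a dimension into a corank, because the rank of a matrix is what can be compared under
    specialization. *)
Lemma dim_lker_matrix (T G : finType) (L : G -> T -> k)
   (U : {vspace {ffun T -> k^o}}) :
   (forall z : {ffun T -> k^o}, reflect (forall g, \sum_t L g t * z t = 0) (z \in U)) ->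
  (\dim U = #|T| - \rank (\matrix_(i < #|T|, j < #|G|) L (enum_val j) (enum_val i)))%N.
Proof.
move=> HU; set M := \matrix_(i, j) _.
rewrite -mxrank_ker.
pose B := row_base (kermx M).
pose psi (a : 'rV[k]_(\rank (kermx M))) : {ffun T -> k^o} :=
  [ffun t => (a *m B) 0 (enum_rank t)].
have psi_lin : linear psi.
  by move=> c a b; apply/ffunP=> t; rewrite !ffunE mulmxDl -scalemxAl !mxE.
pose psiL : {linear 'rV[k]_(\rank (kermx M)) -> {ffun T -> k^o}} :=
  HB.pack psi (GRing.isLinear.Build _ _ _ _ _ psi_lin).
have psiE a : linfun psiL a = psi a by rewrite lfunE.
have -> : U = limg (linfun psiL).
  apply/vspaceP => z; apply/HU/memv_imgP => [h|[a _ ->] g].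
    pose v : 'rV[k]_#|T| := \row_i z (enum_val i).
    have : (v <= B)%MS.
      rewrite eq_row_base; apply/sub_kermxP/rowP => j; rewrite !mxE.
      rewrite -[RHS](h (enum_val j)) [RHS](reindex _ (onW_bij _ (enum_val_bij T))).
      by apply: eq_bigr => i _; rewrite !mxE mulrC.
    case/submxP=> a E; exists a; first by rewrite memvf.
    by rewrite psiE; apply/ffunP=> t; rewrite !ffunE -E !mxE enum_rankK.
  have : (a *m B <= kermx M)%MS by rewrite (submx_trans (submxMl _ _)) // eq_row_base.
  move/sub_kermxP/rowP/(_ (enum_rank g)); rewrite !mxE => {2}<-.
  rewrite (reindex _ (onW_bij _ (enum_val_bij T))).
  by apply: eq_bigr => i _; rewrite psiE !ffunE enum_valK [RHS]mulrC !mxE enum_rankK.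
have /lker0P inj : injective (linfun psiL).
  move=> a b; rewrite !psiE => /ffunP E.
  apply: (row_free_inj (row_base_free (kermx M))); apply/rowP => i.
  by have := E (enum_val i); rewrite !ffunE enum_valK.
by rewrite limg_dim_eq ?dimvf ?/dim /= ?mul1n // (eqP inj) capv0.
Qed.

Section Slices.
Variables (I T : finType) (U : {vspace {ffun T -> k^o}}).

Let glue (c : {ffun I -> subvs_of U}) : {ffun I * T -> k^o} :=
  [ffun p => vsval (c p.1) p.2].

Let glue_linear : linear glue.
Proof. by move=> a c d; apply/ffunP=> p; rewrite !ffunE /=. Qed.

HB.instance Definition _ := GRing.isLinear.Build _ _ _ _ glue glue_linear.

Definition slices : {vspace {ffun I * T -> k^o}} := limg (linfun glue).

Lemma mem_slices (z : {ffun I * T -> k^o}) :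
  reflect (forall i, [ffun t => z (i, t)] \in U) (z \in slices).
Proof.
apply: (iffP memv_imgP) => [[c _ ->] i|h].
  have -> : [ffun t => linfun glue c (i, t)] = vsval (c i).
    by apply/ffunP=> t; rewrite ffunE lfunE /= ffunE.
  exact: subvsP.
exists [ffun i => Subvs (h i)]; first by rewrite memvf.
by apply/ffunP=> -[i t]; rewrite lfunE /= !ffunE /= ?ffunE.
Qed.

Lemma dim_slices : \dim slices = (#|I| * \dim U)%N.
Proof.
have /lker0P inj : injective (linfun glue).
  move=> c d; rewrite !lfunE /= => /ffunP E; apply/ffunP=> i.
  by apply/val_inj/ffunP=> t; have := E (i, t); rewrite !ffunE.
by rewrite /slices limg_dim_eq ?dimvf ?(eqP inj) ?capv0.
Qed.
End Slices.

End Vect.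

(** * Surjectivity and dimensions *)

Section Surj.
Variables (k : fieldType) (X J : finType) (Q : J -> X -> X -> k).
Implicit Types m : nat.

Definition relmap m (z : {ffun word X m -> k^o}) : {ffun relgen X J m -> k^o} :=
  [ffun g => \sum_w relcoef Q g w *: z w].

Fact relmap_linear m : linear (@relmap m).
Proof.
move=> a z z'; apply/ffunP=> g; rewrite !ffunE scaler_sumr -big_split /=.
by apply: eq_bigr => w _; rewrite !ffunE scalerDr !scalerA [a * _]mulrC.
Qed.

HB.instance Definition _ m :=
  GRing.isLinear.Build _ _ _ _ (@relmap m) (@relmap_linear m).

Definition perp m : {vspace {ffun word X m -> k^o}} := lker (linfun (@relmap m)).

Lemma mem_perp m (z : {ffun word X m -> k^o}) : reflect (inU Q z) (z \in perp m).
Proof.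
rewrite memv_ker lfunE /=; apply: (iffP eqP) => [/ffunP h g|h].
  by have := h g; rewrite !ffunE.
by apply/ffunP=> g; rewrite !ffunE h.
Qed.

Lemma mem_perp_fun m (z : word X m -> k^o) : (finfun z \in perp m) <-> inU Q z.
Proof.
split=> [/mem_perp|h]; last apply/mem_perp.
  by apply: inU_ext => w; rewrite ffunE.
by move: h; apply: inU_ext => w; rewrite ffunE.
Qed.

(** The last map V (x) U_(m+1) -> Q^* (x) U_m is onto, in terms of plain functions; [surjP] is the
    version with subspaces. *)
Definition surj m : Prop :=
  forall t : J -> word X m -> k^o, (forall j, inU Q (t j)) ->
  exists c : X -> word X m.+1 -> k^o, (forall x, inU Q (c x)) /\
    forall j w, \sum_x \sum_y Q j x y *: c x (y, w) = t j w.

Definition headmap m (c : {ffun word X m.+2 -> k^o}) : {ffun J * word X m -> k^o} :=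
  [ffun p => \sum_x \sum_y Q p.1 x y *: c (x, (y, p.2))].

Fact headmap_linear m : linear (@headmap m).
Proof.
move=> a z z'; apply/ffunP=> p; rewrite !ffunE scaler_sumr -big_split /=.
apply: eq_bigr => x _; rewrite scaler_sumr -big_split /=; apply: eq_bigr => y _.
by rewrite !ffunE scalerDr !scalerA [a * _]mulrC.
Qed.

HB.instance Definition _ m :=
  GRing.isLinear.Build _ _ _ _ (@headmap m) (@headmap_linear m).

Let VU m : {vspace {ffun word X m.+2 -> k^o}} := slices X (perp m.+1).

Lemma mem_VU m (c : {ffun word X m.+2 -> k^o}) :
  reflect (forall x, inU Q (slice c x)) (c \in VU m).
Proof.
apply: (iffP (mem_slices _ _)) => h x.
  exact: (mem_perp_fun (slice c x)).1 (h x).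
exact: (mem_perp_fun (slice c x)).2 (h x).
Qed.

Lemma perpSS m : perp m.+2 = (VU m :&: lker (linfun (@headmap m)))%VS.
Proof.
apply/vspaceP=> z; rewrite memv_cap; apply/mem_perp/andP.
  move/inUSS=> [h1 h2]; split; first by apply/mem_VU.
  by rewrite memv_ker lfunE /=; apply/eqP/ffunP=> p; rewrite !ffunE h2.
move=> [/mem_VU h1]; rewrite memv_ker lfunE /= => /eqP/ffunP h2.
by apply/inUSS; split=> // j u; have := h2 (j, u); rewrite !ffunE.
Qed.

(** Contracting the first two letters produces combinations of double slices, and slices stay in
    U. *)
Lemma headmap_sub m : (linfun (@headmap m) @: VU m <= slices J (perp m))%VS.
Proof.
apply/subvP=> _ /memv_imgP[c /mem_VU hc ->]; apply/mem_slices=> j.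
apply/mem_perp_fun.
apply: (inU_ext (z := fun u => \sum_x \sum_y Q j x y *: slice (slice c x) y u)).
  by move=> u; rewrite lfunE /= ffunE.
apply: inU_sum => x; apply: inU_sum => y; apply: inU_scale; exact: inU_slice.
Qed.

Lemma surjP m : surj m <-> (slices J (perp m) <= linfun (@headmap m) @: VU m)%VS.
Proof.
split=> [h|/subvP h t ht].
  apply/subvP=> t /mem_slices ht.
  have [|c [hc E]] := h (fun j w => t (j, w)); first by move=> j; apply/mem_perp_fun.
  apply/memv_imgP; exists [ffun p : X * word X m.+1 => c p.1 p.2].
    by apply/mem_VU=> x; move: (hc x); apply: inU_ext => w; rewrite /slice ffunE.
  apply/ffunP=> -[j w]; rewrite lfunE /= ffunE -E /=.
  by apply: eq_bigr => x _; apply: eq_bigr => y _; rewrite ffunE.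
have /h/memv_imgP[c /mem_VU hc /ffunP E] :
    [ffun p : J * word X m => t p.1 p.2] \in slices J (perp m).
  apply/mem_slices=> j; apply/mem_perp; move: (ht j).
  by apply: inU_ext => w; rewrite !ffunE.
exists (slice c); split=> // j w.
by have := E (j, w); rewrite lfunE /= !ffunE => ->.
Qed.

Lemma dim_headmap m :
  (\dim (perp m.+2) + \dim (linfun (@headmap m) @: VU m) = #|X| * \dim (perp m.+1))%N.
Proof. by rewrite perpSS limg_ker_dim dim_slices. Qed.

Lemma dim_perp_ge m :
  (#|X| * \dim (perp m.+1) <= \dim (perp m.+2) + #|J| * \dim (perp m))%N.
Proof. by rewrite -dim_headmap leq_add2l -dim_slices dimvS // headmap_sub. Qed.

Lemma surj_dimP m :
  surj m <->
  (\dim (perp m.+2) + #|J| * \dim (perp m) <= #|X| * \dim (perp m.+1))%N.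
Proof.
rewrite surjP -dim_headmap leq_add2l -dim_slices.
split=> [|h]; first exact: dimvS.
by have /eqP -> : (linfun (@headmap m) @: VU m == slices J (perp m))%VS
  by rewrite eqEdim headmap_sub.
Qed.

Lemma dim_perp0 : \dim (perp 0) = 1%N.
Proof.
have -> : perp 0 = fullv by apply/vspaceP=> z; rewrite memvf; apply/mem_perp/inU0.
by rewrite dimvf /dim /= card_unit muln1.
Qed.

Lemma dim_perp1 : \dim (perp 1) = #|X|.
Proof.
have -> : perp 1 = fullv by apply/vspaceP=> z; rewrite memvf; apply/mem_perp/inU1.
by rewrite dimvf /dim /= card_prod card_unit !muln1.
Qed.
End Surj.

(** Inductively u_(m+2)(Q) <= u_(m+2)(T) = n u_(m+1) - q u_m <= u_(m+2)(Q), where n and q are the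
    numbers of letters and of relations. So the dimensions agree up to M+1, and surjectivity is a
    statement about dimensions. *)
Lemma surj_transfer (k F : fieldType) (X J : finType)
    (Q : J -> X -> X -> k) (T : J -> X -> X -> F) (M : nat) :
  (forall m, \dim (perp Q m) <= \dim (perp T m))%N ->
  (forall m, (m < M)%N -> surj T m) -> forall m, (m < M)%N -> surj Q m.
Proof.
move=> le sT.
have eq m : (m <= M.+1)%N -> \dim (perp Q m) = \dim (perp T m).
  elim/ltn_ind: m => -[|[|m]] IH hm; rewrite ?dim_perp0 ?dim_perp1 //.
  have := surj_dimP T m; have := dim_perp_ge Q m; have := le m.+2.
  have E1 := IH m.+1 (ltnSn _) (ltnW hm); have E0 := IH m (ltnW (ltnSn _)) (ltnW (ltnW hm)).
  by move=> h1 h2 [/(_ (sT m hm)) h3 _]; rewrite -E0 -E1 in h3; lia.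
move=> m hm; apply/surj_dimP.
have [e0 e1 e2] : [/\ m <= M.+1, m.+1 <= M.+1 & m.+2 <= M.+1]%N by split; lia.
rewrite (eq _ e0) (eq _ e1) (eq _ e2).
exact/(surj_dimP T)/sT.
Qed.

(* The ratios r_m = u_(m+1)/u_m satisfy r_(m+1) = n - q/r_m, so they decrease by
   (r^2 - n r + q)/r >= 1/(4n) at each step when n^2 < 4q. *)
Lemma linear_recurrence_pos (n q : nat) (u : nat -> nat) :
  u 0 = 1%N -> u 1 = n -> (forall m, u m.+2 + q * u m = n * u m.+1)%N ->
  (4 * q <= n ^ 2)%N.
Proof.
move=> u0 u1 rec; rewrite leqNgt; apply/negP=> lt.
(* Cassini's identity for the recurrence; it keeps two consecutive terms from vanishing together. *)
have cassini m : (u m.+1 ^ 2 + q * u m ^ 2 = n * u m * u m.+1 + q ^ m.+1)%N.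
  elim: m => [|m IH]; first by rewrite u0 u1; nia.
  rewrite (expnS q m.+1); move: (rec m) (q ^ m.+1)%N IH.
  move: (u m) (u m.+1) (u m.+2) => a b c E p IH.
  have E' : (b ^ 2 = a * c + p)%N.
    have : (a * (c + q * a) = a * (n * b))%N by rewrite E.
    by move: IH; nia.
  have : (c * (c + q * a) = c * (n * b))%N by rewrite E.
  rewrite E'; nia.
have q0 : (0 < q)%N by nia.
have pos m : (0 < u m)%N.
  case: (posnP (u m)) => // z; case: m z => [|m] z; first by rewrite u0 in z.
  have := rec m; rewrite z muln0 => /eqP; rewrite addn_eq0 muln_eq0.
  case/andP=> _; rewrite eqn0Ngt q0 => /eqP z'.
  have := cassini m; rewrite z z' !muln0 => /esym/eqP.
  by rewrite expn_eq0 eqn0Ngt q0.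
have n0 : (0 < n)%N by rewrite -u1.
(* The bound r_m <= n - m/(4n), cleared of denominators. *)
have H m : (4 * n * u m.+1 + m * u m <= 4 * n ^ 2 * u m)%N.
  elim: m => [|m IH]; first by rewrite u0 u1; nia.
  have := rec m; have := pos m; have := pos m.+1.
  move: (u m) (u m.+1) (u m.+2) IH => a b c IH b0 a0 E.
  have ba : (b <= n * a)%N by rewrite -(leq_pmul2l (m := 4 * n)) ?muln_gt0 ?n0 //; lia.
  suff le : (m.+1 * b <= 4 * n * q * a)%N.
    have : (4 * n * (c + q * a) = 4 * n * (n * b))%N by rewrite E.
    by lia.
  rewrite -(leq_pmul2l a0).
  have h1 : (b * (4 * n * b + m * a) <= b * (4 * n ^ 2 * a))%N by rewrite leq_mul.
  have h2 : (n * a * a * (n ^ 2 + 1) <= n * a * a * (4 * q))%N by rewrite leq_mul // addn1.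
  have h3 : (a * b <= a * (n * a))%N by rewrite leq_mul.
  have h4 : (n * (4 * (n * a) * b) <= n * ((n * a) ^ 2 + 4 * b ^ 2))%N.
    by rewrite leq_mul //; have := (nat_Cauchy (n * a) (2 * b)).1; rewrite -!mulnn; lia.
  by lia.
(* At m = 4n^2 the bound forces u_(m+1) = 0. *)
have := pos (4 * n ^ 2).+1; have := H (4 * n ^ 2)%N.
by rewrite -[leqRHS]add0n leq_add2r leqn0 !muln_eq0 /= (gtn_eqF n0) => /eqP ->.
Qed.


Section Surj1.
Variables (k : fieldType).

(** [surj Q 1] written out in letters: U_1 is all of V, so the targets [t] are arbitrary, and each
    [c x] lies in U_2. *)
Definition surj1 (X J : finType) (Q : J -> X -> X -> k) : Prop :=
  forall t : J -> X -> k, exists c : X -> X -> X -> k,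
    (forall x j, \sum_y \sum_z Q j y z * c x y z = 0) /\
    (forall j z, \sum_x \sum_y Q j x y * c x y z = t j z).

Lemma surj1_surj (X J : finType) (Q : J -> X -> X -> k) : surj1 Q -> surj Q 1.
Proof.
move=> h t _; have [c [h1 h2]] := h (fun j z => t j (z, tt)).
exists (fun x w => c x w.1 w.2.1); split; last by move=> j [z []]; apply: h2.
by move=> x; apply/inUSS; split=> [y|j []]; [apply: inU1 | apply: h1].
Qed.

Lemma surj1_surj0 (X J : finType) (Q : J -> X -> X -> k) (x0 : X) :
  surj1 Q -> surj Q 0.
Proof.
move=> h t _; have [c [h1 h2]] := h (fun j z => t j tt).
exists (fun x w => c x w.1 x0); split; last by move=> j []; apply: h2.
by move=> x; apply: inU1.
Qed.

Lemma surj1_sub (X J J' : finType) (i : J' -> J) (Q : J -> X -> X -> k) :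
  injective i -> surj1 Q -> surj1 (fun j => Q (i j)).
Proof.
move=> inj_i h t.
have [c [h1 h2]] := h (fun j z => if [pick j' | i j' == j] is Some j' then t j' z else 0).
exists c; split=> [x j|j z]; rewrite ?h1 // h2.
by case: pickP => [j' /eqP/inj_i ->|/(_ j)] //; rewrite eqxx.
Qed.

Lemma surj1_bij (X X' J : finType) (h : X' -> X) (Q : J -> X -> X -> k) :
  bijective h -> surj1 Q -> surj1 (fun j x y => Q j (h x) (h y)).
Proof.
move=> bij_h hQ t; case: (bij_h) => g hg gh.
have [c [h1 h2]] := hQ (fun j z => t j (g z)).
exists (fun x y z => c (h x) (h y) (h z)); split=> [x j|j z].
  rewrite -[RHS](h1 (h x) j) [RHS](reindex h (onW_bij _ bij_h)).
  by apply: eq_bigr => y _; rewrite [RHS](reindex h (onW_bij _ bij_h)).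
rewrite -[in RHS](hg z) -h2 [RHS](reindex h (onW_bij _ bij_h)).
by apply: eq_bigr => y _; rewrite [RHS](reindex h (onW_bij _ bij_h)).
Qed.

End Surj1.

(** The preimage of [t] is the sum of the a_j (x) b_j t_j. The element b_j t_j lies in U_(m+1): its
    slices are zero or sums of elements of U_m, and no relation starts with a letter b_j.
    Distinctness of the monomials keeps the targets apart. *)
Lemma surj_monomial (k : fieldType) (X J : finType) (a b : J -> X) :
  injective (fun j => (a j, b j)) -> (forall i j, a i != b j) ->
  forall m, surj (fun j x y => if (a j == x) && (b j == y) then 1 else 0 : k) m.
Proof.
move=> inj_ab dab m t ht.
pose P x y j := (a j == x) && (b j == y).
have pickE j : [pick i | P (a j) (b j) i] = Some j.
  case: pickP => [i /andP[/eqP ea /eqP eb]|/(_ j)]; last by rewrite /P !eqxx.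
  by congr Some; apply: inj_ab; rewrite ea eb.
have sumE (V : lmodType k) (F : X -> X -> V) j :
  \sum_x \sum_y (if P x y j then 1 else 0 : k) *: F x y = F (a j) (b j).
  rewrite (bigD1 (a j)) //= [X in _ + X]big1 ?addr0 => [|x /negbTE ne]; last first.
    by rewrite big1 // => y _; rewrite /P [a j == x]eq_sym ne scale0r.
  rewrite (bigD1 (b j)) //= [X in _ + X]big1 ?addr0 => [|y /negbTE ne].
    by rewrite /P !eqxx scale1r.
  by rewrite /P [b j == y]eq_sym ne andbF scale0r.
exists (fun x w => if [pick i | P x w.1 i] is Some i then t i w.2 else 0); split.
  move=> x; case: m t ht => [|m] t ht; first exact: inU1.
  apply/inUSS; split=> [y|j u]; rewrite ?sumE /slice /=.
    case: pickP => [i _|_]; last exact: inU_const0.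
    by apply: inU_ext (ht i) => w.
  case: pickP => // i /andP[_ /eqP E].
  by have := dab j i; rewrite E eqxx.
by move=> j w; rewrite sumE /= pickE.
Qed.

(** * Special relations *)

Lemma sum_option (T : finType) (V : nmodType) (F : option T -> V) :
  \sum_x F x = F None + \sum_x F (Some x).
Proof.
rewrite (bigD1 None) //=; congr (_ + _).
by rewrite (reindex_omap Some id) => [|[]] //=; apply: eq_bigl => x; rewrite eqxx.
Qed.

Section Special.
Variables (k : fieldType) (U : finType).

(* The relations xy and x^2 + y^2 in the letters x = false, y = true. *)
Definition base_rel (l p q : bool) : k :=
  if l then (if p == q then 1 else 0) else if ~~ p && q then 1 else 0.

Definition even_rel (j : U * U * bool) (x y : U * bool) : k :=
  if (j.1.1 == x.1) && (j.1.2 == y.1) then base_rel j.2 x.2 y.2 else 0.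

(** For W = <x, y> and R = <xy, x^2 + y^2>, the space W^3 is the direct sum of W R and R W, so an
    element with pairing 0 on W R and prescribed pairing on R W exists and is unique; this is it.
    Tensoring with U^3 preserves the decomposition, so each triple of elements of U can be solved
    separately. *)
Definition base_sol (t1 t2 : bool -> k) (p q r : bool) : k :=
  match p, q, r with
  | false, false, false => - t1 true
  | false, true, false => t1 false
  | false, true, true => t1 true
  | true, false, false => - t2 true
  | true, true, false => t2 false + t1 true
  | true, true, true => t2 true
  | _, false, true => 0
  end.

Lemma sum_even_rel j (F : U * bool -> U * bool -> k) :
  \sum_x \sum_y even_rel j x y * F x y
  = \sum_p \sum_q base_rel j.2 p q * F (j.1.1, p) (j.1.2, q).
Proof.
rewrite sum_pair.
rewrite (bigD1 j.1.1) //= [X in _ + X]big1 ?addr0 => [|a /negbTE ne]; last first.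
  rewrite big1 // => p _; rewrite big1 // => y _.
  by rewrite /even_rel /= [j.1.1 == a]eq_sym ne mul0r.
apply: eq_bigr => p _.
rewrite sum_pair.
rewrite (bigD1 j.1.2) //= [X in _ + X]big1 ?addr0 => [|b /negbTE ne]; last first.
  by rewrite big1 // => q _; rewrite /even_rel /= [j.1.2 == b]eq_sym ne andbF mul0r.
by apply: eq_bigr => q _; rewrite /even_rel /= !eqxx.
Qed.

Definition even_sol (t : U * U * bool -> U * bool -> k) (x y z : U * bool) : k :=
  base_sol (fun r => t (x.1, y.1, false) (z.1, r))
           (fun r => t (x.1, y.1, true) (z.1, r)) x.2 y.2 z.2.

Lemma even_sol1 t x j : \sum_y \sum_z even_rel j y z * even_sol t x y z = 0.
Proof.
rewrite sum_even_rel; case: x j => [a p] [[b c] l].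
by rewrite !big_bool /= /base_rel /even_sol; case: l; case: p => /=; ring.
Qed.

Lemma even_sol2 t j z : \sum_x \sum_y even_rel j x y * even_sol t x y z = t j z.
Proof.
rewrite sum_even_rel; case: z j => [a p] [[b c] l].
by rewrite !big_bool /= /base_rel /even_sol; case: l; case: p => /=; ring.
Qed.

Lemma surj1_even : surj1 even_rel.
Proof.
move=> t; exists (even_sol t).
by split; [apply: even_sol1 | apply: even_sol2].
Qed.

(* With z = None, the additional relations are x z - z phi(x), where phi is the
   endomorphism x |-> x + y, y |-> y of each pair of letters.  It is chosen so
   that R and (phi (x) phi) R are complementary for R = <xy, x^2 + y^2>. *)
Definition shear (g : U * bool -> k) (x : U * bool) : k :=
  g x + (if x.2 then 0 else g (x.1, true)).

Definition odd_rel (j : U * U * bool + U * bool) (x y : option (U * bool)) : k :=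
  match j, x, y with
  | inl j, Some x, Some y => even_rel j x y
  | inr j, Some x, None => if j == x then 1 else 0
  | inr j, None, Some y => - shear (fun u => if u == y then 1 else 0) j
  | _, _, _ => 0
  end.

Lemma sum_odd_rel_inl j (F : option (U * bool) -> option (U * bool) -> k) :
  \sum_x \sum_y odd_rel (inl j) x y * F x y
  = \sum_x \sum_y even_rel j x y * F (Some x) (Some y).
Proof.
rewrite sum_option /= [X in X + _]big1 ?add0r => [|y _]; last by rewrite mul0r.
by apply: eq_bigr => x _; rewrite sum_option /= mul0r add0r.
Qed.

Lemma sum_odd_rel_inr j (F : option (U * bool) -> option (U * bool) -> k) :
  \sum_x \sum_y odd_rel (inr j) x y * F x y
  = F (Some j) None - shear (fun u => F None (Some u)) j.
Proof.
rewrite sum_option /= sum_option /= mul0r add0r addrC; congr (_ + _).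
  rewrite -[RHS](sum_pick j (fun x => F (Some x) None)); apply: eq_bigr => x _.
  rewrite sum_option /= [X in _ + X]big1 ?addr0 => [|y _]; last by rewrite mul0r.
  by case: ifP; rewrite ?mul1r ?mul0r.
have sp (u : U * bool) : \sum_y (if u == y then 1 else 0) * F None (Some y) = F None (Some u).
  rewrite -[RHS](sum_pick u (fun x => F None (Some x))); apply: eq_bigr => x _.
  by case: ifP; rewrite ?mul1r ?mul0r.
under eq_bigr do rewrite mulNr; rewrite sumrN; congr (- _).
rewrite /shear -sp; case: j => a [] /=.
  by rewrite addr0; apply: eq_bigr => y _; rewrite addr0.
by rewrite -sp -big_split /=; apply: eq_bigr => y _; rewrite mulrDl.
Qed.

Section OddSolution.
Variable t : U * U * bool + U * bool -> option (U * bool) -> k.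

Let s x y := t (inr x) (Some y).

(** The values required of [alpha] on (phi (x) phi) R: the targets at words ending in z, less the
    contribution of the targets [s] that is picked up when z is moved to the front. *)
Let v a b l := t (inl (a, b, l)) None
  - \sum_p \sum_q base_rel l p q * shear (fun y => s (a, p) y) (b, q).

(** The entries at words starting with z: zero on R and equal to [v] on (phi (x) phi) R. For each
    pair of elements of U these are four conditions on four unknowns, uniquely solvable since the
    two spaces are complementary. *)
Let alpha (x y : U * bool) : k :=
  match x.2, y.2 with
  | false, false => - v x.1 y.1 false
  | false, true => 0
  | true, true => v x.1 y.1 false
  | true, false => v x.1 y.1 true - v x.1 y.1 false
  end.

Let beta x y := shear (fun u => alpha u y) x + s x y.

(** The relations x z - z phi(x) push z to the left: entries with z in the middle are dictated by
    those with z in front, and entries with z at the end by those with z in the middle. *)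
Definition odd_sol (x y z : option (U * bool)) : k :=
  match x, y, z with
  | Some x, Some y, Some z => even_sol (fun j z => t (inl j) (Some z)) x y z
  | None, Some x, Some y => alpha x y
  | Some x, None, Some y => beta x y
  | Some x, Some y, None => shear (beta x) y
  | Some x, None, None => t (inr x) None
  | _, _, _ => 0
  end.

Lemma odd_sol1 x j : \sum_y \sum_z odd_rel j y z * odd_sol x y z = 0.
Proof.
case: j => j; last first.
  rewrite sum_odd_rel_inr; case: x => [x|] /=; first by rewrite subrr.
  by rewrite /shear if_same addr0 subr0.
rewrite sum_odd_rel_inl; case: x => [x|]; first exact: even_sol1.
rewrite sum_even_rel; case: j => [[a b] l].
by rewrite !big_bool /= /base_rel /alpha; case: l => /=; ring.
Qed.

Lemma odd_sol2 j z : \sum_x \sum_y odd_rel j x y * odd_sol x y z = t j z.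
Proof.
case: j => j; last first.
  rewrite sum_odd_rel_inr; case: z => [z|] /=.
    by rewrite /beta addrAC subrr add0r.
  by rewrite /shear if_same addr0 subr0.
rewrite sum_odd_rel_inl; case: z => [z|].
  exact: (even_sol2 (fun j z => t (inl j) (Some z))).
rewrite sum_even_rel; case: j => [[a b] l] /=.
rewrite !big_bool /= /base_rel /shear /beta /shear /alpha /v /=.
by rewrite !big_bool /shear /base_rel; case: l => /=; ring.
Qed.
End OddSolution.

Lemma surj1_odd : surj1 odd_rel.
Proof.
move=> t; exists (odd_sol t).
by split; [apply: odd_sol1 | apply: odd_sol2].
Qed.

End Special.

Lemma injection_ord (q : nat) (J : finType) :
  (q <= #|J|)%N -> exists i : 'I_q -> J, injective i.
Proof.
move=> le; exists (fun i => enum_val (widen_ord le i)) => i j /enum_val_inj.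
by move/(congr1 val) => /= E; apply: val_inj.
Qed.

Lemma bijection_ord (n : nat) (X : finType) :
  #|X| = n -> exists h : 'I_n -> X, bijective h.
Proof. by move=> <-; exists (@enum_val X predT); apply: enum_val_bij. Qed.

(** The special relations number 2m^2 for n = 2m and 2m^2 + 2m for n = 2m + 1, in both cases the
    integer part of n^2/2. Any subfamily of them inherits surjectivity. *)
Lemma exists_surj1 (k : fieldType) (n q : nat) :
  (2 * q <= n ^ 2)%N -> exists T : 'I_q -> 'I_n -> 'I_n -> k, surj1 T.
Proof.
move=> le; pose m := n./2.
have En : n = (odd n + m.*2)%N by rewrite odd_double_half.
case: (boolP (odd n)) En => _ /= En.
  have [h bij_h] : exists h : 'I_n -> option ('I_m * bool), bijective h.
    by apply: bijection_ord; rewrite card_option card_prod card_ord card_bool; lia.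
  have [i inj_i] : exists i : 'I_q -> ('I_m * 'I_m * bool + 'I_m * bool)%type, injective i.
    by apply: injection_ord; rewrite card_sum !card_prod !card_ord card_bool; nia.
  by eexists; apply: surj1_sub inj_i (surj1_bij bij_h (@surj1_odd k 'I_m)).
have [h bij_h] : exists h : 'I_n -> ('I_m * bool)%type, bijective h.
  by apply: bijection_ord; rewrite card_prod card_ord card_bool; lia.
have [i inj_i] : exists i : 'I_q -> ('I_m * 'I_m * bool)%type, injective i.
  by apply: injection_ord; rewrite !card_prod !card_ord card_bool; nia.
by eexists; apply: surj1_sub inj_i (surj1_bij bij_h (@surj1_even k 'I_m)).
Qed.

(** Monomials ab with a in the first half of the letters and b in the rest: their number is the
    integer part of n^2/4. *)
Lemma exists_surj (k : fieldType) (n q : nat) :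
  (4 * q <= n ^ 2)%N ->
  exists T : 'I_q -> 'I_n -> 'I_n -> k, forall m, surj T m.
Proof.
move=> le; pose h := n./2.
have hn : (h <= n)%N by rewrite leq_half_double; lia.
have [i inj_i] : exists i : 'I_q -> ('I_h * 'I_(n - h))%type, injective i.
  apply: injection_ord; rewrite card_prod !card_ord.
  by have := odd_double_half n; rewrite -/h; case: (odd n) => /= E; nia.
have lt j : (h + (i j).2 < n)%N by have := ltn_ord (i j).2; lia.
eexists; apply: (@surj_monomial k 'I_n 'I_q (fun j => widen_ord hn (i j).1)
   (fun j => Ordinal (lt j))) => [j j' [E1 E2]|j j'].
  apply: inj_i; move: E1 E2; case: (i j) (i j') => [a b] [a' b'] /= E1 /addnI E2.
  by congr pair; apply: val_inj.
apply/eqP=> /(congr1 val) /= E.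
by have := ltn_ord (i j).1; rewrite E ltnNge leq_addr.
Qed.

(** * Generic relations *)

Section PrimeField.
Variable k : fieldType.

Definition prime_pred : {pred k} := fun x => `[< in_prime_field x >].

Fact prime_pred_divring_closed : divring_closed prime_pred.
Proof.
split; first by apply/asboolP=> S [].
  move=> x y /asboolP hx /asboolP hy; apply/asboolP=> S hS.
  by case: (hS) => _ hB _; apply: hB; [apply: hx | apply: hy].
move=> x y /asboolP hx /asboolP hy; apply/asboolP=> S hS.
by case: (hS) => _ _ hD; apply: hD; [apply: hx | apply: hy].
Qed.

HB.instance Definition _ :=
  GRing.isDivringClosed.Build k prime_pred prime_pred_divring_closed.

(** The prime field as a field of its own, to serve as coefficient field for polynomials in the
    generic coefficients. *)
Record prime_subfield := PrimeSubfield
  { prime_val : k; _ : prime_val \in prime_pred }.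

HB.instance Definition _ := [isSub for prime_val].
HB.instance Definition _ := [Choice of prime_subfield by <:].
HB.instance Definition _ := [SubChoice_isSubComUnitRing of prime_subfield by <:].
HB.instance Definition _ := [SubComUnitRing_isSubIntegralDomain of prime_subfield by <:].
HB.instance Definition _ := [SubIntegralDomain_isSubField of prime_subfield by <:].

Definition prime_inj : {rmorphism prime_subfield -> k} := \val.

Lemma prime_injP (x : prime_subfield) : in_prime_field (prime_inj x).
Proof. exact/asboolP/(valP x). Qed.

End PrimeField.

Section Specialization.
Variables (F k : fieldType) (S : comNzRingType).
(** To be thought of as a polynomial ring S over F, with [ev] the evaluation at the generic point
    and [ev0] the evaluation at a special point over F. *)
Variables (cst : {rmorphism F -> S}) (ev : {rmorphism S -> k}).
Variable ev0 : {rmorphism S -> F}.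
Hypothesis ev0_cst : cancel cst ev0.
Hypothesis ev_inj : forall s, ev s = 0 -> s = 0.

(** One-sided inverses [P] and [R] of the factors of a full-rank factorization of [M0] turn P M R
    into the identity at the special point. Its determinant is therefore nonzero in S, hence nonzero
    at the generic point. *)
Lemma mxrank_specialize m n (M : 'M[S]_(m, n)) :
  (\rank (map_mx ev0 M) <= \rank (map_mx ev M))%N.
Proof.
set M0 := map_mx ev0 M.
have [P EP] : exists P : 'M_(\rank M0, m), P *m col_base M0 = 1%:M.
  by apply/row_fullP; apply: col_base_full.
have [R ER] : exists R : 'M_(n, \rank M0), row_base M0 *m R = 1%:M.
  by apply/row_freeP; apply: row_base_free.
pose D := map_mx cst P *m M *m map_mx cst R.
have cstK p q (A : 'M_(p, q)) : map_mx ev0 (map_mx cst A) = A.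
  by apply/matrixP=> i j; rewrite !mxE ev0_cst.
have D0 : map_mx ev0 D = 1%:M.
  rewrite !map_mxM !cstK -/M0.
  transitivity (P *m (col_base M0 *m row_base M0) *m R); first by rewrite mulmx_base.
  by rewrite mulmxA EP mul1mx ER.
have : map_mx ev D \in unitmx.
  rewrite unitmxE unitfE det_map_mx; apply: contra_eq_neq (congr1 determinant D0).
  by rewrite det_map_mx => /ev_inj ->; rewrite rmorph0 det1 eq_sym oner_eq0.
rewrite -row_full_unit !map_mxM => /eqP {1}<-.
exact: leq_trans (mxrankM_maxl _ _) (mxrankM_maxr _ _).
Qed.

Lemma dim_perp_specialize (X J : finType) (Q : J -> X -> X -> S) m :
  (\dim (perp (fun j x y => ev (Q j x y)) m)
    <= \dim (perp (fun j x y => ev0 (Q j x y)) m))%N.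
Proof.
have memU (K : fieldType) (phi : {rmorphism S -> K}) (z : {ffun word X m -> K^o}) :
  reflect (forall g, \sum_t phi (relcoef Q g t) * z t = 0)
          (z \in perp (fun j x y => phi (Q j x y)) m).
  have E g : \sum_t relcoef (fun j x y => phi (Q j x y)) g t *: z t
             = \sum_t phi (relcoef Q g t) * z t.
    by apply: eq_bigr => t _; rewrite relcoef_morph.
  by apply: (iffP (mem_perp _ _)) => h g; [rewrite -E | rewrite E]; apply: h.
rewrite (dim_lker_matrix (memU k ev)) (dim_lker_matrix (memU F ev0)).
pose M := \matrix_(i < #|word X m|, j < #|relgen X J m|)
  relcoef Q (enum_val j) (enum_val i).
rewrite leq_sub2l //.
rewrite (_ : \matrix_(i, j) ev0 _ = map_mx ev0 M); last by apply/matrixP=> i j; rewrite !mxE.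
rewrite (_ : \matrix_(i, j) ev _ = map_mx ev M); last by apply/matrixP=> i j; rewrite !mxE.
exact: mxrank_specialize.
Qed.

(* C B is invertible at the special point, and the columns of
   det(C B) - B adj(C B) C are orthogonal to the rows of C. *)
Lemma annihilator_specialize r N (C : 'M[S]_(r, N)) :
  row_free (map_mx ev0 C) ->
  exists Q : 'M[S]_N, C *m Q = 0 /\
    forall u : 'cV_N, map_mx ev0 C *m u = 0 -> map_mx ev0 Q *m u = u.
Proof.
move=> /row_freeP[B EB]; pose M := C *m map_mx cst B.
have cstB : map_mx ev0 (map_mx cst B) = B.
  by apply/matrixP=> i j; rewrite !mxE ev0_cst.
exists ((\det M)%:M - map_mx cst B *m \adj M *m C); split.
  by rewrite mulmxBr !mulmxA mul_mx_adj mul_mx_scalar mul_scalar_mx subrr.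
move=> u Cu0; rewrite map_mxB map_mxM mulmxBl -mulmxA Cu0 mulmx0 subr0.
by rewrite map_scalar_mx /= -det_map_mx map_mxM cstB EB det1 mul1mx.
Qed.

End Specialization.

Lemma inU_span (R : nzRingType) (M : lmodType R) (X I J : finType)
    (T : I -> X -> X -> R) (Q : J -> X -> X -> R) (a : I -> J -> R) :
  (forall i x y, T i x y = \sum_j a i j * Q j x y) ->
  forall m (z : word X m -> M), inU Q z -> inU T z.
Proof.
move=> E; elim=> [|[|m] IH] z; [by move=> _; apply: inU0 | by move=> _; apply: inU1 |].
case/inUSS=> h1 h2; apply/inUSS; split=> [x|i u]; first exact/IH/h1.
transitivity (\sum_j a i j *: \sum_x \sum_y Q j x y *: z (x, (y, u))).
  under [RHS]eq_bigr do rewrite scaler_sumr; rewrite [RHS]exchange_big.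
  apply: eq_bigr => x _; under [RHS]eq_bigr do rewrite scaler_sumr.
  rewrite [RHS]exchange_big; apply: eq_bigr => y _; rewrite E scaler_suml.
  by apply: eq_bigr => j _; rewrite scalerA.
by rewrite big1 // => j _; rewrite h2 scaler0.
Qed.

Lemma dim_perp_span (k : fieldType) (X I J : finType)
    (T : I -> X -> X -> k) (Q : J -> X -> X -> k) (a : I -> J -> k) m :
  (forall i x y, T i x y = \sum_j a i j * Q j x y) ->
  (\dim (perp Q m) <= \dim (perp T m))%N.
Proof.
by move=> E; apply/dimvS/subvP=> z /mem_perp h; apply/mem_perp; apply: inU_span E _ _ h.
Qed.

Section Generic.
Import mpoly.
Variables (k : fieldType) (I : finType) (v : I -> k).
Hypothesis gen_v : alg_independent_over_prime_field v.
Let F := prime_subfield k.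

Lemma generic_specialization (c : I -> F) :
  exists (S : comNzRingType) (cst : {rmorphism F -> S}) (ev : {rmorphism S -> k})
    (ev0 : {rmorphism S -> F}) (chi : I -> S),
  [/\ cancel cst ev0, forall s, ev s = 0 -> s = 0,
      forall i, ev (chi i) = v i & forall i, ev0 (chi i) = c i].
Proof.
pose S : comNzRingType := mpoly.mpoly #|I| F.
pose ev : {rmorphism S -> k} :=
  (meval (fun i => v (enum_val i)) \o map_mpoly (prime_inj k))%FUN.
pose ev0 : {rmorphism S -> F} := meval (fun i => c (enum_val i)).
pose cst : {rmorphism F -> S} := @mpoly.mpolyC #|I| F.
exists S, cst, ev, ev0, (fun i => 'X_(enum_rank i)); split.
- by move=> x; rewrite /= mevalC.
(* Algebraic independence enters here: a polynomial over F becomes one over k with all coefficients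
   in the prime field. *)
- move=> s /= /gen_v h; apply/mpolyP=> m; rewrite mpoly.mcoeff0.
  apply: (fmorph_inj (prime_inj k)); rewrite rmorph0 -mcoeff_map_mpoly h ?mpoly.mcoeff0 //.
  by move=> m'; rewrite (mcoeff_map_mpoly (prime_inj k)); apply: prime_injP.
- by move=> i; rewrite /= (map_mpolyX (prime_inj k)) mevalXU enum_rankK.
- by move=> i; rewrite /= mevalXU enum_rankK.
Qed.
End Generic.

Section GenericRelations.
Variables (k : fieldType) (n r : nat) (f : 'I_r -> 'I_n -> 'I_n -> k).
Hypothesis gen_f :
  alg_independent_over_prime_field (fun t : 'I_r * 'I_n * 'I_n => f t.1.1 t.1.2 t.2).
Let F := prime_subfield k.

Lemma generic_dim_Uv (T : 'I_r -> 'I_n -> 'I_n -> F) m :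
  (\dim (perp f m) <= \dim (perp T m))%N.
Proof.
have [S [cst [ev [ev0 [chi [cstK ev_inj chi_v chi_c]]]]]] :=
  generic_specialization gen_f (fun t => T t.1.1 t.1.2 t.2).
have := dim_perp_specialize cstK ev_inj (fun s i j => chi (s, i, j)) m.
have -> : (fun s i j => ev (chi (s, i, j))) = f.
  by apply/funext=> s; apply/funext=> i; apply/funext=> j; rewrite chi_v.
have -> // : (fun s i j => ev0 (chi (s, i, j))) = T.
by apply/funext=> s; apply/funext=> i; apply/funext=> j; rewrite chi_c.
Qed.

(** [f] is specialized to a point [C0] orthogonal to [T]. The family of n^2 elements supplied by
    [annihilator_specialize] is orthogonal to [f] at the generic point and contains [T] in its span
    at [C0]; semicontinuity compares the two. One factor of the pairing has its letters swapped, to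
    match the reversed words of W_a. *)
Lemma generic_annihilator q (T : 'I_q -> 'I_n -> 'I_n -> F) :
  (r + q = n ^ 2)%N ->
  exists (J : finType) (Q : J -> 'I_n -> 'I_n -> k),
    (forall s j, \sum_x \sum_y f s y x * Q j x y = 0) /\
    forall m, (\dim (perp Q m) <= \dim (perp T m))%N.
Proof.
move=> Erq; pose N := #|{: 'I_n * 'I_n}|.
pose ij (a : 'I_N) : 'I_n * 'I_n := enum_val a.
pose TM := \matrix_(i < q, a < N) T i (ij a).2 (ij a).1.
pose K := kermx TM^T.
have rK : (r <= \rank K)%N.
  rewrite mxrank_ker mxrank_tr leq_subRL ?rank_leq_col //.
  apply: (@leq_trans (q + r)); first by rewrite leq_add2r rank_leq_row.
  by rewrite /N card_prod card_ord mulnn addnC Erq.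
(* [T] may be linearly dependent and its annihilator larger than r-dimensional; any r independent
   elements of it will do. *)
pose C0 := rowsub (widen_ord rK) (row_base K).
have C0_free : row_free C0.
  have /row_freeP[B EB] := row_base_free K.
  apply/row_freeP; exists (colsub (widen_ord rK) B).
  rewrite -mxsub_mul EB; apply/matrixP=> i j; rewrite !mxE -val_eqE /=.
  by rewrite val_eqE.
have C0T : C0 *m TM^T = 0.
  rewrite mul_rowsub_mx; apply/matrixP=> i j; rewrite mxE.
  have /sub_kermxP -> : (row_base K <= kermx TM^T)%MS by rewrite eq_row_base.
  by rewrite !mxE.
have [S [cst [ev [ev0 [chi [cstK ev_inj chi_v chi_c]]]]]] :=
  generic_specialization gen_f (fun t => C0 t.1.1 (enum_rank (t.1.2, t.2))).
pose C := \matrix_(s < r, a < N) chi (s, (ij a).1, (ij a).2).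
have EC0 : map_mx ev0 C = C0.
  by apply/matrixP=> s a; rewrite !mxE chi_c /= -surjective_pairing enum_valK !mxE.
have [|Q [CQ Qid]] := annihilator_specialize cstK (C := C); first by rewrite EC0.
pose Qf (j : 'I_N) x y := Q (enum_rank (y, x)) j.
exists 'I_N, (fun j x y => ev (Qf j x y)); split=> [s j|m].
  move/matrixP/(_ s j): CQ => /(congr1 ev); rewrite !mxE rmorph0 rmorph_sum => E.
  apply: etrans E; rewrite exchange_big.
  rewrite [RHS](reindex _ (onW_bij _ (enum_rank_bij _))) [RHS]sum_pair.
  apply: eq_bigr => x _; apply: eq_bigr => y _.
  by rewrite rmorphM !mxE /ij enum_rankK chi_v.
apply: leq_trans (dim_perp_specialize cstK ev_inj Qf m) _.
apply: (dim_perp_span (a := fun i a => TM i a)) => i x y.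
have : C0 *m (row i TM)^T = 0.
  apply/matrixP=> s j; have /matrixP/(_ s i) := C0T; rewrite [_ 0 s i]mxE => E.
  by rewrite [RHS]mxE -E !mxE; apply: eq_bigr => a _; rewrite !mxE.
rewrite -EC0 => /Qid/matrixP/(_ (enum_rank (y, x)) 0); rewrite !mxE /ij enum_rankK => <-.
by apply: eq_bigr => a _; rewrite !mxE mulrC.
Qed.
End GenericRelations.

(** * Presented algebras *)

Section LeftDerivations.
Variables (k : fieldType) (B : lalgType k) (n : nat) (x : 'I_n -> B).
Variables (eps : B -> k) (der : 'I_n -> {linear B -> B}).
Hypothesis xZ : forall i c b, x i * (c *: b) = c *: (x i * b).
Hypothesis der_xM : forall i j b, der i (x j * b) = if j == i then b else 0.
Hypothesis decomp : forall b, b = eps b *: 1 + \sum_i x i * der i b.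

(** [der i] removes an initial letter x_i, and this is the product rule of a Fox derivative: as soon
    as [a] has positive degree the initial letter comes from [a], and its constant term lets [b]
    through. *)
Lemma derM i a b : der i (a * b) = der i a * b + eps a *: der i b.
Proof.
have -> : a * b = eps a *: b + \sum_j x j * (der j a * b).
  rewrite {1}(decomp a) mulrDl -scalerAl mul1r mulr_suml.
  by congr (_ + _); apply: eq_bigr => j _; rewrite mulrA.
rewrite linearP linear_sum addrC; congr (_ + _).
rewrite (bigD1 i) //= der_xM eqxx big1 ?addr0 // => j /negbTE ji.
by rewrite der_xM ji.
Qed.

Variables (g : B) (q : 'I_n -> 'I_n -> k).
Hypotheses (eps_g : eps g = 0) (eps_dg : forall i, eps (der i g) = 0).
Hypothesis ddg : forall i j, der j (der i g) = q i j *: 1.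

Lemma der_quad i : der i g = \sum_j q i j *: x j.
Proof.
rewrite [LHS]decomp eps_dg scale0r add0r; apply: eq_bigr => j _.
by rewrite ddg xZ mulr1.
Qed.

Lemma quad_decomp : g = \sum_i \sum_j q i j *: (x i * x j).
Proof.
rewrite {1}(decomp g) eps_g scale0r add0r; apply: eq_bigr => i _.
by rewrite der_quad mulr_sumr; apply: eq_bigr => j _; rewrite xZ.
Qed.

Lemma der_quadM i b : der i (g * b) = \sum_j q i j *: (x j * b).
Proof.
rewrite derM eps_g scale0r addr0 der_quad mulr_suml.
by apply: eq_bigr => j _; rewrite scalerAl.
Qed.
End LeftDerivations.

Section FreeAlgebra.
Variables (k : fieldType) (n : nat).
Local Notation FA := {malg k[{fmonom 'I_n}]}.
Local Notation mon := {fmonom 'I_n}.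
Implicit Types (g h : FA) (w v : mon) (i j : 'I_n).

Lemma fmu_inj i j w v : mmul (fmu i) w = mmul (fmu j) v -> i = j /\ w = v.
Proof.
move/(congr1 (@fmonom_val _)); rewrite !fmM !fmU => -[-> E].
by split=> //; apply: val_inj.
Qed.

Lemma fmonomP w : w = mone \/ exists i v, w = mmul (fmu i) v.
Proof.
case E: (fmonom_val w) => [|i s].
  by left; apply: val_inj; rewrite /= E fm1.
by right; exists i, (FMonom s); apply: val_inj; rewrite /= fmM fmU E.
Qed.

Definition letter i : FA := << fmu i >>.
Fact lmul_key : unit. Proof. by []. Qed.
Definition lmul i h : FA := locked_with lmul_key (letter i * h).
Lemma lmulE i h : lmul i h = letter i * h. Proof. exact: unlock. Qed.

Lemma mcoeff_letterM i h v : (lmul i h)@_v =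
  \sum_(w <- msupp h) h@_w *+ (mmul (fmu i) w == v).
Proof.
rewrite lmulE /letter malgM_def fgmulUg raddf_sum; apply: eq_bigr => w _.
by rewrite /= mul1r mcoeffU.
Qed.

Lemma mcoeff_letterM1 i h : (lmul i h)@_mone = 0.
Proof.
rewrite mcoeff_letterM big1 // => w _.
by rewrite fmM_eq1 fm1_eq1.
Qed.

Lemma mcoeff_letterMU i j h w :
  (lmul i h)@_(mmul (fmu j) w) = if i == j then h@_w else 0.
Proof.
rewrite mcoeff_letterM; case: eqVneq => [<-|ne].
  rewrite [in RHS](monalgE h) raddf_sum; apply: eq_bigr => v _.
  rewrite /= mcoeffU; congr (_ *+ nat_of_bool _).
  by apply/eqP/eqP => [/fmu_inj[]|->].
rewrite big1 // => v _; case: eqP => // /fmu_inj[E].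
by rewrite E eqxx in ne.
Qed.

Definition der i g : FA :=
  [malg w in [fset FMonom (behead (fmonom_val v)) | v in msupp g]%fset => g@_(mmul (fmu i) w)].

Lemma mcoeff_der i g w : (der i g)@_w = g@_(mmul (fmu i) w).
Proof.
rewrite mcoeffE; case: ifPn => // /imfsetP H.
case: (msuppP g) => // hs; case: H; exists (mmul (fmu i) w) => //=.
by apply: val_inj; rewrite /= fmM fmU.
Qed.

Lemma der_linear i : linear (der i).
Proof.
by move=> a g h; apply/malgP=> w; rewrite mcoeff_der !mcoeffD !mcoeffZ !mcoeff_der.
Qed.

HB.instance Definition _ i := GRing.isLinear.Build _ _ _ _ (der i) (@der_linear i).

Lemma der_letterM i j h : der i (lmul j h) = if j == i then h else 0.
Proof.
apply/malgP=> w; rewrite mcoeff_der mcoeff_letterMU.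
by case: ifP => // _; rewrite mcoeff0.
Qed.

Lemma der_decomp g : g = g@_mone *: 1 + \sum_i lmul i (der i g).
Proof.
apply/malgP=> w; rewrite mcoeffD mcoeffZ mcoeff1 raddf_sum /=.
case: (fmonomP w) => [->|[i [v ->]]].
  by rewrite eqxx mulr1 big1 ?addr0 // => i _; apply: mcoeff_letterM1.
rewrite fmM_eq1 fm1_eq1 mulr0 add0r.
rewrite (eq_bigr (fun j => if i == j then g@_(mmul (fmu i) v) else 0)); first exact/esym/sum_pick.
by move=> j _; rewrite -mcoeff_der; apply: etrans (mcoeff_letterMU _ _ _ _) _;
   rewrite eq_sym; case: eqP => // ->.
Qed.

Lemma letterMZ i c g : lmul i (c *: g) = c *: (lmul i g).
Proof.
apply/malgP=> w; apply: etrans (esym (mcoeffZ _ _ _)).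
case: (fmonomP w) => [->|[j [v ->]]].
  exact: etrans (mcoeff_letterM1 _ _) (esym (etrans (congr1 _ (mcoeff_letterM1 _ _)) (mulr0 c))).
apply: etrans (mcoeff_letterMU _ _ _ _) (esym (etrans (congr1 _ (mcoeff_letterMU _ _ _ _)) _)).
by case: ifP => _; [apply/esym/mcoeffZ | apply: mulr0].
Qed.

Definition quad_coeff g i j : k := g@_(mmul (fmu i) (fmu j)).

Section Quad.
Variable g : FA.
Hypothesis hg : free_homog 2 g.

Lemma free_homog2_out w : fdeg w != 2%N -> g@_w = 0.
Proof. by case: (msuppP g) => // /hg ->. Qed.

Lemma free_homog2_1 : g@_mone = 0.
Proof. by apply: free_homog2_out; rewrite fdeg1. Qed.

Lemma der_free_homog2_1 i : (der i g)@_mone = 0.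
Proof. by rewrite mcoeff_der free_homog2_out // mulm1 fdegU. Qed.

Lemma der2_free_homog2 i j : der j (der i g) = quad_coeff g i j *: 1.
Proof.
apply/malgP=> w; rewrite !mcoeff_der mcoeffZ mcoeff1.
case: eqVneq => [->|ne]; first by rewrite mulm1 mulr1.
by rewrite mulr0 free_homog2_out // !fdegM !fdegU !add1n !eqSS fdeg_eq0.
Qed.
End Quad.
End FreeAlgebra.

Section Presentation.
Variables (k : fieldType) (B : lalgType k) (n r : nat) (x : 'I_n -> B).
Variables (eps : B -> k) (der : 'I_n -> {linear B -> B}).
Hypothesis xZ : forall i c b, x i * (c *: b) = c *: (x i * b).
Hypothesis der_xM : forall i j b, der i (x j * b) = if j == i then b else 0.
Hypothesis decomp : forall b, b = eps b *: 1 + \sum_i x i * der i b.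
Variables (f : 'I_r -> B) (q : 'I_r -> 'I_n -> 'I_n -> k).
Hypotheses (eps_f : forall s, eps (f s) = 0).
Hypotheses (eps_df : forall s i, eps (der i (f s)) = 0).
Hypothesis ddf : forall s i j, der j (der i (f s)) = q s i j *: 1.

Variables (A : algType k) (pi : {lrmorphism B -> A}).
Hypothesis pi_surj : forall a : A, exists b, pi b = a.
Hypothesis pi_ker : forall b, pi b = 0 <->
  exists (N : nat) (c d : 'I_N -> B) (s : 'I_N -> 'I_r),
    b = \sum_t c t * f (s t) * d t.

Let pi_f s : pi (f s) = 0.
Proof.
apply/pi_ker; exists 1%N, (fun=> 1), (fun=> 1), (fun=> s).
by rewrite big_ord1 mul1r mulr1.
Qed.

Lemma pres_rel s : \sum_i \sum_j q s i j *: (pi (x i) * pi (x j)) = 0.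
Proof.
rewrite -[RHS](pi_f s) [in RHS](quad_decomp xZ decomp (eps_f s) (eps_df s) (ddf s)).
rewrite linear_sum; apply: eq_bigr => i _; rewrite linear_sum; apply: eq_bigr => j _.
by rewrite linearZ /= rmorphM.
Qed.

Lemma pres_gen (a : A) : exists c y, a = c%:A + \sum_i pi (x i) * y i.
Proof.
have [b <-] := pi_surj a; exists (eps b), (fun i => pi (der i b)).
rewrite {1}(decomp b) linearD linearZ /= rmorph1 linear_sum; congr (_ + _).
by apply: eq_bigr => i _; rewrite rmorphM.
Qed.

(** Exactness of R (x) A -> V (x) A -> A. The sum of the x_i g_i, for lifts g_i of the y_i, is a sum
    of terms c f_s d in the ideal. Applying [der i] and then [pi] kills every term in which the
    derivative falls on c, and leaves eps(c) der_i(f_s) d. *)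
Lemma pres_syz (y : 'I_n -> A) :
  \sum_i pi (x i) * y i = 0 ->
  exists u : 'I_r -> A,
    forall i, y i = \sum_s \sum_j q s i j *: (pi (x j) * u s).
Proof.
have /fin_all_exists[g Eg] := fun i => pi_surj (y i).
under eq_bigr do rewrite -Eg -rmorphM; rewrite -linear_sum => /pi_ker[N [c [d [s E]]]].
exists (fun s' => \sum_(t | s t == s') eps (c t) *: pi (d t)) => i.
have -> : y i = pi (der i (\sum_j x j * g j)).
  rewrite linear_sum (bigD1 i) //= der_xM eqxx big1 ?addr0 ?Eg // => j /negbTE ji.
  by rewrite der_xM ji.
transitivity (\sum_t \sum_j q (s t) i j *: (pi (x j) * (eps (c t) *: pi (d t)))).
  rewrite E !linear_sum; apply: eq_bigr => t _.
  rewrite -mulrA (derM der_xM decomp) linearD /= rmorphM rmorphM /= pi_f mul0r mulr0 add0r.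
  rewrite linearZ /= (der_quadM xZ der_xM decomp (eps_f _) (eps_df _) (ddf _)).
  rewrite linear_sum scaler_sumr; apply: eq_bigr => j _.
  by rewrite linearZ /= rmorphM -scalerAr !scalerA mulrC.
rewrite (partition_big s xpredT) //=; apply: eq_bigr => s' _.
rewrite exchange_big; apply: eq_bigr => j _.
by rewrite mulr_sumr scaler_sumr; apply: eq_bigr => t /eqP ->.
Qed.

End Presentation.

(** The start of the resolution of k, with R (x) A -> V (x) A -> A -> k exact. From here on the
    presentation enters only through these facts. *)
Record quad_alg_facts (k : fieldType) (n r : nat) (A : cg_algebra k)
    (f : 'I_r -> 'I_n -> 'I_n -> k) (x : 'I_n -> A) : Prop := QuadAlgFacts {
  qa_hom : forall i, cg_hom 1 (x i);
  qa_rel : forall s, \sum_i \sum_j f s i j *: (x i * x j) = 0;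
  qa_gen : forall a : A, exists c y, a = c%:A + \sum_i x i * y i;
  qa_syz : forall y : 'I_n -> A, \sum_i x i * y i = 0 ->
    exists u : 'I_r -> A, forall i, y i = \sum_s \sum_j f s i j *: (x j * u s)
}.

Lemma presentation_facts (k : fieldType) (n r : nat) (A : cg_algebra k)
    (f : 'I_r -> free_algebra k n) :
  (forall s, free_homog 2 (f s)) -> presented_by A f ->
  exists x : 'I_n -> A, quad_alg_facts (fun s => quad_coeff (f s)) x.
Proof.
move=> hf [pi [pi_surj pi_hom pi_ker]].
pose B : lalgType k := free_algebra k n.
pose x i : B := letter k i.
pose d i : {linear B -> B} := @der k n i.
have xZ i c (b : B) : x i * (c *: b) = c *: (x i * b).
  by have := letterMZ i c b; rewrite !lmulE.
have dxM i j (b : B) : d i (x j * b) = if j == i then b else 0.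
  by have := der_letterM i j b; rewrite lmulE.
have dec (b : B) : b = mcoeff mone b *: 1 + \sum_i x i * d i b.
  have := der_decomp b; under eq_bigr do rewrite lmulE; exact.
exists (fun i => pi (x i)); split.
- by move=> i; apply: pi_hom => w; rewrite msuppU1 inE => /eqP ->; rewrite fdegU.
- exact: (pres_rel xZ dec (fun s => free_homog2_1 (hf s)) (fun s => der_free_homog2_1 (hf s))
    (fun s => der2_free_homog2 (hf s)) pi_ker).
- exact: (pres_gen dec pi_surj).
- exact: (pres_syz xZ dxM dec (fun s => free_homog2_1 (hf s)) (fun s => der_free_homog2_1 (hf s))
    (fun s => der2_free_homog2 (hf s)) pi_surj pi_ker).
Qed.

(** * Homogeneous components *)

Section Components.
Variables (k : fieldType) (A : cg_algebra k).
Implicit Types (a b : A) (m : nat).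

Lemma homZ m (c : k) a : cg_hom m a -> cg_hom m (c *: a).
Proof. by move=> h; rewrite -[_ *: a]addr0; apply: cg_homP => //; apply: cg_hom0. Qed.

Lemma homD m a b : cg_hom m a -> cg_hom m b -> cg_hom m (a + b).
Proof. by move=> ha hb; rewrite -[a]scale1r; apply: cg_homP. Qed.

Lemma homB m a b : cg_hom m a -> cg_hom m b -> cg_hom m (a - b).
Proof. by move=> ha hb; rewrite addrC -scaleN1r; apply: cg_homP. Qed.

Lemma hom_sum m (I : Type) (s : seq I) (P : pred I) (F : I -> A) :
  (forall i, P i -> cg_hom m (F i)) -> cg_hom m (\sum_(i <- s | P i) F i).
Proof. by move=> h; apply: big_ind => //; [apply: cg_hom0 | apply: homD]. Qed.

Lemma hcomp_exists a : exists c : nat -> A, (forall m, cg_hom m (c m)) /\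
  exists N, (forall m, (N <= m)%N -> c m = 0) /\ a = \sum_(m < N) c m.
Proof.
have [N [c [hc ->]]] := cg_span a.
exists (fun m => if (m < N)%N then c m else 0); split.
  by move=> m; case: ifP => // _; apply: cg_hom0.
exists N; split; first by move=> m; rewrite ltnNge => ->.
by apply: eq_bigr => m _; rewrite ltn_ord.
Qed.

Definition hcomp m a : A := sval (cid (hcomp_exists a)) m.

Lemma hcomp_hom m a : cg_hom m (hcomp m a).
Proof. exact: (svalP (cid (hcomp_exists a))).1. Qed.

Lemma widen_sum (c : nat -> A) (N M : nat) :
  (N <= M)%N -> (forall m, (N <= m)%N -> c m = 0) ->
  \sum_(m < M) c m = \sum_(m < N) c m.
Proof.
move=> le h; rewrite -(subnKC le) big_split_ord /= [X in _ + X]big1 ?addr0 //.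
by move=> m _; rewrite h // leq_addr.
Qed.

Lemma hcomp_sumP a : exists N, (forall m, (N <= m)%N -> hcomp m a = 0) /\
  forall M, (N <= M)%N -> a = \sum_(m < M) hcomp m a.
Proof.
have [_ [N [h E]]] := svalP (cid (hcomp_exists a)); exists N; split=> // M le.
by rewrite (widen_sum le h).
Qed.

Lemma hcomp_unique (c : nat -> A) N a : (forall m, cg_hom m (c m)) ->
  (forall m, (N <= m)%N -> c m = 0) -> a = \sum_(m < N) c m ->
  forall m, hcomp m a = c m.
Proof.
move=> hc h E m; have [N' [_ E']] := hcomp_sumP a.
pose M := (maxn (maxn N N') m.+1).
have leN : (N <= M)%N by rewrite !leq_max leqnn.
have leN' : (N' <= M)%N by rewrite !leq_max leqnn orbT.
apply/eqP; rewrite -subr_eq0; apply/eqP.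
apply: (@cg_direct _ A M (fun m => hcomp m a - c m)); last exact: leq_maxr.
  by move=> l; apply: homB => //; apply: hcomp_hom.
by rewrite sumrB -E' // (widen_sum leN h) -E subrr.
Qed.

Lemma hcomp_linear m : linear (hcomp m).
Proof.
move=> c a b; have [N [h E]] := hcomp_sumP a; have [N' [h' E']] := hcomp_sumP b.
pose M := maxn N N'.
pose g m := c *: hcomp m a + hcomp m b.
have hg l : cg_hom l (g l) by apply: cg_homP; apply: hcomp_hom.
have z l : (M <= l)%N -> g l = 0.
  by rewrite geq_max /g => /andP[/h -> /h' ->]; rewrite scaler0 addr0.
apply: (hcomp_unique hg z); rewrite {1}(E M) ?leq_maxl // {1}(E' M) ?leq_maxr //.
by rewrite scaler_sumr -big_split.
Qed.

HB.instance Definition _ m := GRing.isLinear.Build _ _ _ _ (hcomp m) (@hcomp_linear m).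

Lemma hcomp_homog m m' a : cg_hom m a -> hcomp m' a = if m' == m then a else 0.
Proof.
move=> ha; pose c l := if l == m then a else 0.
have hc l : cg_hom l (c l) by rewrite /c; case: eqP => [->|_] //; apply: cg_hom0.
apply: (hcomp_unique (c := c) (N := m.+1)) => //.
  by move=> l lt; rewrite /c gtn_eqF.
rewrite big_ord_recr /= /c eqxx big1 ?add0r // => l _.
by rewrite ltn_eqF.
Qed.

Lemma hcomp_id m a : cg_hom m a -> hcomp m a = a.
Proof. by move/hcomp_homog->; rewrite eqxx. Qed.

Lemma hcomp_mull i m a b :
  cg_hom i a -> hcomp m (a * b) = if (i <= m)%N then a * hcomp (m - i) b else 0.
Proof.
move=> ha; have [N [_ E]] := hcomp_sumP b; pose M := maxn N (m - i).+1.
rewrite {1}(E M) ?leq_maxl // mulr_sumr linear_sum /=.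
have h l : hcomp m (a * hcomp l b) = if m == (i + l)%N then a * hcomp l b else 0.
  by apply: hcomp_homog; apply: cg_homM => //; apply: hcomp_hom.
rewrite (eq_bigr _ (fun (l : 'I_M) _ => h l)); case: leqP => le; last first.
  by rewrite big1 // => l _; rewrite ltn_eqF // ltn_addr.
rewrite (bigD1 (Ordinal (leq_maxr N (m - i).+1))) //= subnKC // eqxx.
rewrite big1 ?addr0 // => l; rewrite -val_eqE /= => ne.
by rewrite -[m in m == _](subnKC le) eqn_add2l eq_sym (negbTE ne).
Qed.

Lemma aug_alg (c : k) : cg_aug A c%:A = c.
Proof. by rewrite linearZ /= rmorph1 /GRing.scale /= mulr1. Qed.

Lemma hom0_aug a : cg_hom 0 a -> a = (cg_aug A a)%:A.
Proof. by case/cg_connected=> c ->; rewrite aug_alg. Qed.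

Lemma hom0_alg (c : k) : cg_hom 0 (c%:A : A).
Proof. exact/homZ/cg_hom1. Qed.

End Components.

Section QuadAlg.
Variables (k : fieldType) (n r : nat) (A : cg_algebra k).
Variables (f : 'I_r -> 'I_n -> 'I_n -> k) (x : 'I_n -> A).
Hypothesis qa : quad_alg_facts f x.
Let hx := qa_hom qa.

Lemma aug_x i : cg_aug A (x i) = 0.
Proof. exact: cg_aug_pos (hx i). Qed.

Lemma aug0_gen (a : A) : cg_aug A a = 0 -> exists y, a = \sum_i x i * y i.
Proof.
have [c [y ->]] := qa_gen qa a.
rewrite linearD linear_sum big1 /= => [|i _]; last by rewrite rmorphM /= aug_x mul0r.
by rewrite addr0 aug_alg => ->; exists y; rewrite scale0r add0r.
Qed.

Lemma hcomp_gen m (y : 'I_n -> A) :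
  hcomp m.+1 (\sum_i x i * y i) = \sum_i x i * hcomp m (y i).
Proof.
rewrite linear_sum; apply: eq_bigr => i _ /=.
by rewrite (hcomp_mull _ _ (hx i)) /= subn1.
Qed.

Lemma hom_gen m (a : A) : cg_hom m.+1 a ->
  exists y, (forall i, cg_hom m (y i)) /\ a = \sum_i x i * y i.
Proof.
move=> ha; have [y E] := aug0_gen (cg_aug_pos (ltn0Sn m) ha).
exists (fun i => hcomp m (y i)); split; first by move=> i; apply: hcomp_hom.
by rewrite -hcomp_gen -E hcomp_id.
Qed.

(** By [qa_syz] the entries of a syzygy lie in the right ideal generated by the letters, which has
    no component of degree 0. *)
Lemma x_indep (c : 'I_n -> k) : \sum_i c i *: x i = 0 -> forall i, c i = 0.
Proof.
move=> E i; have [|u Eu] := qa_syz qa (y := fun i => (c i)%:A).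
  by rewrite -[RHS]E; apply: eq_bigr => j _; rewrite -scalerAr mulr1.
have := Eu i; move/(congr1 (hcomp 0)); rewrite (hcomp_id (hom0_alg _ _)).
rewrite linear_sum big1 /= => [|s _].
  by move/(congr1 (cg_aug A)); rewrite aug_alg linear0.
rewrite linear_sum big1 //= => j _; rewrite linearZ /=.
by rewrite (hcomp_mull _ _ (hx j)) scaler0.
Qed.

(** The degree 1 part of [qa_syz]: only the constant terms of the [u s] contribute. *)
Lemma quad_indep (t : 'I_n -> 'I_n -> k) :
  \sum_i \sum_j t i j *: (x i * x j) = 0 ->
  exists c : 'I_r -> k, forall i j, t i j = \sum_s c s * f s i j.
Proof.
move=> E; have [|u Eu] := qa_syz qa (y := fun i => \sum_j t i j *: x j).
  rewrite -[RHS]E; apply: eq_bigr => i _; rewrite mulr_sumr.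
  by apply: eq_bigr => j _; rewrite scalerAr.
exists (fun s => cg_aug A (hcomp 0 (u s))) => i j.
apply/eqP; rewrite -subr_eq0; apply/eqP; move: j; apply: x_indep.
under eq_bigr do rewrite scalerBl.
rewrite sumrB; apply/eqP; rewrite subr_eq0; apply/eqP.
have /(congr1 (hcomp 1)) := Eu i; rewrite hcomp_id; last first.
  by apply: hom_sum => j _; apply/homZ/hx.
move=> ->; rewrite linear_sum; under [RHS]eq_bigr do rewrite scaler_suml.
rewrite [RHS]exchange_big; apply: eq_bigr => s _ /=; rewrite linear_sum.
apply: eq_bigr => j _; rewrite linearZ /= (hcomp_mull _ _ (hx j)) /= subnn.
by rewrite {1}(hom0_aug (hcomp_hom 0 (u s))) -scalerAr mulr1 scalerA mulrC.
Qed.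

End QuadAlg.

(** * The resolution by syzygies *)

Section FreeModule.
Variables (k : fieldType) (A : cg_algebra k).

Lemma aug_comp m (a : A) : cg_aug A (hcomp m a) = if m == 0%N then cg_aug A a else 0.
Proof.
case: m => [|m] /=; last exact: cg_aug_pos (hcomp_hom _ _).
have [N [_ E]] := hcomp_sumP a; rewrite [in RHS](E N.+1) // big_ord_recl linearD /=.
rewrite linear_sum big1 ?addr0 // => i _.
exact: cg_aug_pos (hcomp_hom _ _).
Qed.

Section OneModule.
Variables (G : choiceType) (deg : G -> nat).
Local Notation P := {malg A[G]}.
Implicit Types (p : P) (j m : nat).
Local Notation homog := (free_mod_homog deg).

Definition mcomp j p : P :=
  [malg g in msupp p => if (deg g <= j)%N then hcomp (j - deg g) p@_g else 0].

Lemma mcoeff_mcomp j p g :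
  (mcomp j p)@_g = if (deg g <= j)%N then hcomp (j - deg g) p@_g else 0.
Proof.
rewrite mcoeffE; case: msuppP => // _.
by rewrite linear0 if_same.
Qed.

Lemma mcomp_additive j : additive (mcomp j).
Proof.
move=> p q; apply/malgP=> g; rewrite mcoeffB !mcoeff_mcomp mcoeffB.
by case: ifP; rewrite ?subr0 ?linearB.
Qed.

HB.instance Definition _ j := GRing.isAdditive.Build _ _ (mcomp j) (mcomp_additive j).

Lemma mcomp_homog j p : homog j (mcomp j p).
Proof. by move=> g; rewrite mcoeff_mcomp; case: (deg g <= j)%N => //; apply: hcomp_hom. Qed.

Lemma homog_mcomp j j' p : homog j p -> mcomp j' p = if j' == j then p else 0.
Proof.
move=> hp; apply/malgP=> g; rewrite mcoeff_mcomp; have := hp g.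
case: (leqP (deg g) j) => le h; last first.
  by rewrite h linear0 if_same; case: eqP => _; rewrite ?h ?mcoeff0.
rewrite (hcomp_homog _ h); case: (leqP (deg g) j') => le'.
  by rewrite -(eqn_add2r (deg g)) !subnK //; case: ifP; rewrite ?mcoeff0.
by rewrite ltn_eqF ?mcoeff0 // (leq_trans le').
Qed.

Lemma mcomp_id j p : homog j p -> mcomp j p = p.
Proof. by move/homog_mcomp->; rewrite eqxx. Qed.

Lemma mcomp_sumP p : exists N, forall M, (N <= M)%N -> p = \sum_(j < M) mcomp j p.
Proof.
pose B g := sval (cid (hcomp_sumP p@_g)).
have HB g M : (B g <= M)%N -> p@_g = \sum_(m < M) hcomp m p@_g.
  exact: (svalP (cid (hcomp_sumP p@_g))).2.
exists (\sum_(g <- msupp p) (deg g + B g))%N => M le.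
apply/malgP=> g; rewrite raddf_sum /=.
case: (msuppP p g) => hg; last first.
  rewrite big1 // => j _; rewrite mcoeff_mcomp mcoeff_outdom // linear0.
  by rewrite if_same.
have leg : (deg g + B g <= M)%N.
  by apply: leq_trans le; rewrite (big_fsetD1 g) //= leq_addr.
have ledeg : (deg g <= M)%N by apply: leq_trans leg; apply: leq_addr.
move: leg; rewrite -(subnKC ledeg) leq_add2l; move: (M - deg g)%N => M' leM'.
rewrite [LHS](HB g M') // big_split_ord /=.
rewrite [X in _ = X + _]big1 ?add0r => [|j _].
  by apply: eq_bigr => m _; rewrite mcoeff_mcomp leq_addr addKn.
by rewrite mcoeff_mcomp leqNgt ltn_ord.
Qed.

Lemma mcomp_scale i j a p : cg_hom i a ->
  mcomp j (a *: p) = if (i <= j)%N then a *: mcomp (j - i) p else 0.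
Proof.
move=> ha; apply/malgP=> g; rewrite mcoeff_mcomp mcoeffZ (hcomp_mull _ _ ha).
case: (leqP i j) => le.
  rewrite mcoeffZ mcoeff_mcomp; case: (leqP (deg g) j) => h1;
    case: (leqP (deg g) (j - i)) => h2; rewrite ?mulr0 //.
  - have -> : (i <= j - deg g)%N by clear -h1 h2 le; lia.
    by rewrite subnAC.
  - have -> // : (i <= j - deg g)%N = false.
    by apply/negbTE; rewrite -ltnNge; clear -h1 h2 le; lia.
  - by exfalso; clear -h1 h2 le; lia.
rewrite mcoeff0; case: leqP => // h.
have -> // : (i <= j - deg g)%N = false.
by apply/negbTE; rewrite -ltnNge; clear -h le; lia.
Qed.

End OneModule.

Section LinearExtension.
Variables (G : choiceType) (V : lmodType A) (h : G -> V).

Definition lext (p : {malg A[G]}) : V := \sum_(g <- msupp p) p@_g *: h g.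

Lemma lextEw (D : {fset G}) p : (msupp p `<=` D)%fset ->
  lext p = \sum_(g <- D) p@_g *: h g.
Proof.
move=> le; rewrite [LHS](big_fset_incl _ le) => //= x xD /mcoeff_outdom ->.
by rewrite scale0r.
Qed.

Lemma lext_linear : linear lext.
Proof.
move=> a p q; pose D := (msupp p `|` msupp q)%fset.
rewrite (lextEw (D := D) (p := p)) ?fsubsetUl // (lextEw (D := D) (p := q)) ?fsubsetUr //.
rewrite (lextEw (D := D)) => [|]; last first.
  by apply: fsubset_trans (msuppD_le _ _) _; apply: fsetSU; apply: msuppZ_le.
rewrite scaler_sumr -big_split; apply: eq_bigr => g _ /=.
by rewrite mcoeffD mcoeffZ scalerDl scalerA.
Qed.

HB.instance Definition _ := GRing.isLinear.Build _ _ _ _ lext lext_linear.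

Lemma lextU a g : lext << a *g g >> = a *: h g.
Proof. by rewrite (lextEw msuppU_le) big_seq_fset1 mcoeffUU. Qed.

End LinearExtension.

Lemma lext_homog (G G' : choiceType) (deg : G -> nat) (deg' : G' -> nat)
    (h : G -> {malg A[G']}) j p :
  (forall g, free_mod_homog deg' (deg g) (h g)) ->
  free_mod_homog deg j p -> free_mod_homog deg' j (lext h p).
Proof.
move=> hh hp g'; rewrite /lext raddf_sum /=.
have T g : if (deg' g' <= j)%N then cg_hom (j - deg' g') (p@_g *: h g)@_g'
   else (p@_g *: h g)@_g' = 0.
  rewrite mcoeffZ; have := hp g; have := hh g g'.
  case: (leqP (deg g) j) => l1; last first.
    by move=> _ ->; rewrite mul0r; case: ifP => // _; apply: cg_hom0.
  case: (leqP (deg' g') (deg g)) => l2 h1 h2; last first.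
    by rewrite h1 mulr0; case: ifP => // _; apply: cg_hom0.
  rewrite (leq_trans l2 l1).
  have -> : (j - deg' g' = (j - deg g) + (deg g - deg' g'))%N by lia.
  exact: cg_homM.
case: leqP T => _ T; first exact: hom_sum.
by rewrite big1.
Qed.

Lemma homog_map_mcomp (G G' : choiceType) (deg : G -> nat) (deg' : G' -> nat)
    (d : {linear {malg A[G]} -> {malg A[G']}}) j p :
  (forall j p, free_mod_homog deg j p -> free_mod_homog deg' j (d p)) ->
  d (mcomp deg j p) = mcomp deg' j (d p).
Proof.
move=> hd; have [N E] := mcomp_sumP deg p.
rewrite [in RHS](E (maxn N j.+1)) ?leq_maxl // linear_sum raddf_sum /=.
rewrite (bigD1 (Ordinal (leq_maxr N j.+1))) //=.
rewrite (homog_mcomp _ (hd _ _ (mcomp_homog _ _ _))) eqxx big1 ?addr0 // => i.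
rewrite -val_eqE /= => ne.
by rewrite (homog_mcomp _ (hd _ _ (mcomp_homog _ _ _))) eq_sym (negbTE ne).
Qed.

(** A graded free module together with the submodule that the next differential has to cover. *)
Record stage := Stage {
  st_gen : choiceType;
  st_deg : st_gen -> nat;
  st_sub : {malg A[st_gen]} -> Prop
}.

(** The tautological generators: all homogeneous elements of the submodule. Each carries its degree
    explicitly, since 0 is homogeneous of every degree. *)
Definition cover (s : stage) : choiceType :=
  {e : nat * {malg A[st_gen s]} | `[< free_mod_homog (@st_deg s) e.1 e.2 /\ st_sub e.2 >]}.

Definition cover_map (s : stage) : {malg A[cover s]} -> {malg A[st_gen s]} :=
  lext (fun e => (val e).2).

Lemma cover_mapU s (e : cover s) : cover_map << e >> = (val e).2.
Proof. by rewrite /cover_map lextU scale1r. Qed.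

HB.instance Definition _ s := GRing.Linear.on (@cover_map s).

Definition next (s : stage) : stage :=
  @Stage (cover s) (fun e => (val e).1) (fun q => cover_map q = 0).

Definition graded_sub (s : stage) : Prop :=
  st_sub (s := s) 0 /\
  (forall a p q, st_sub (s := s) p -> st_sub q -> st_sub (a *: p + q)) /\
  (forall j p, st_sub (s := s) p -> st_sub (mcomp (@st_deg s) j p)).

Lemma cover_map_homog s j p :
  free_mod_homog (@st_deg (next s)) j p -> free_mod_homog (@st_deg s) j (cover_map p).
Proof. by apply: lext_homog => -[e h] /=; case/asboolP: h. Qed.

Lemma graded_next s : graded_sub (next s).
Proof.
split; [exact: linear0 | split=> [a p q /= hp hq|j p /= hp]].
  by rewrite linearP /= hp hq scaler0 addr0.
by rewrite (homog_map_mcomp _ _ (@cover_map_homog s)) /= hp raddf0.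
Qed.

Lemma cover_exact s p : graded_sub s -> st_sub (s := s) p <-> exists q, p = cover_map q.
Proof.
move=> [h0 [hL hC]]; split=> [hp|[q ->]].
  have [N E] := mcomp_sumP (@st_deg s) p.
  have mem j : `[< free_mod_homog (@st_deg s) j (mcomp (@st_deg s) j p)
                   /\ st_sub (mcomp (@st_deg s) j p) >].
    by apply/asboolP; split; [apply: mcomp_homog | apply: hC].
  pose e j : cover s := exist _ (j, mcomp (@st_deg s) j p) (mem j).
  exists (\sum_(j < N) << e j >>); rewrite linear_sum {1}(E N) //.
  by apply: eq_bigr => j _; rewrite /= cover_mapU.
rewrite /cover_map /lext; apply: (big_ind (fun p => st_sub (s := s) p)) => //.
  by move=> p1 p2 h1 h2; rewrite -[p1]scale1r; apply: hL.
move=> e _; rewrite -[_ *: _]addr0; apply: hL => //.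
by case: e => [e he] /=; case/asboolP: he.
Qed.

Definition first_stage : stage :=
  @Stage unit (fun=> 0%N) (fun p => cg_aug A p@_tt = 0).

Lemma graded_first : graded_sub first_stage.
Proof.
split; [by rewrite /= mcoeff0 linear0 | split=> [a p q /= hp hq|j p /= hp]].
  by rewrite mcoeffD mcoeffZ linearD rmorphM /= hp hq mulr0 addr0.
by rewrite mcoeff_mcomp /= aug_comp hp if_same.
Qed.

Definition syzygies i : stage := iter i next first_stage.

Lemma graded_syzygies i : graded_sub (syzygies i).
Proof. by case: i => [|i]; [apply: graded_first | apply: graded_next]. Qed.

Definition unit_aug (p : {malg A[unit]}) : k := cg_aug A p@_tt.

Lemma unit_aug_additive : additive unit_aug.
Proof. by move=> p q; rewrite /unit_aug mcoeffB linearB. Qed.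

HB.instance Definition _ := GRing.isAdditive.Build _ _ unit_aug unit_aug_additive.

Definition syzygy_resolution : graded_free_resolution A.
Proof.
refine (@GradedFreeResolution k A (fun i => st_gen (syzygies i))
  (fun i => @st_deg (syzygies i)) (fun i => @cover_map (syzygies i)) unit_aug
  _ _ _ _ _ _).
- by move=> i j p; apply: cover_map_homog.
- move=> j p j0 /(_ tt) /=; rewrite subn0 => h; exact: cg_aug_pos h.
- by move=> a p /=; rewrite /unit_aug mcoeffZ rmorphM.
- by move=> c; exists << c%:A *g tt >>; rewrite /= /unit_aug mcoeffUU aug_alg.
- by move=> p; apply: (cover_exact p graded_first).
- by move=> i p; apply: (cover_exact p (graded_syzygies i.+1)).
Defined.

End FreeModule.

(** * The Koszul complex and Tor *)

(** [Y] is a generalized inverse, L Y L = L, so 1 - Y L projects onto the kernel of [L]. Its entries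
    are scalars, so it also acts on functions with values in any module. *)
Lemma exists_projector (k : fieldType) (T G : finType) (L : G -> T -> k) :
  exists Y : T -> G -> k, forall g t',
    \sum_t L g t * ((t == t')%:R - \sum_g' Y t g' * L g' t') = 0.
Proof.
pose M := \matrix_(i < #|G|, j < #|T|) L (enum_val i) (enum_val j).
exists (fun t g => pinvmx M (enum_rank t) (enum_rank g)) => g t'.
under eq_bigr do rewrite mulrBr; rewrite sumrB; apply/eqP; rewrite subr_eq0; apply/eqP.
rewrite (bigD1 t') //= eqxx mulr1 big1 ?addr0 => [|t /negbTE ->]; last by rewrite mulr0.
have /matrixP/(_ (enum_rank g) (enum_rank t')) := mulmxKpV (submx_refl M).
rewrite -mulmxA !mxE !enum_rankK => <-.
rewrite [LHS](reindex _ (onW_bij _ (enum_rank_bij T))); apply: eq_bigr => t _.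
rewrite !mxE !enum_rankK; congr (_ * _).
rewrite [LHS](reindex _ (onW_bij _ (enum_rank_bij G))); apply: eq_bigr => g' _.
by rewrite !mxE !enum_rankK.
Qed.

Section Koszul.
Variables (k : fieldType) (n : nat) (A : cg_algebra k) (x : 'I_n -> A).
Variables (J : finType) (Q : J -> 'I_n -> 'I_n -> k).
Local Notation word := (word 'I_n).

Let QA j a b : A := (Q j a b)%:A.

(* W_a (x) M, where W_a is the intersection of the V^i R V^(a-2-i); the first
   entry of a word is its last letter. *)
Definition inW (M : lmodType A) a (z : word a -> M) : Prop := inU QA z.

Lemma relcoefA m (g : relgen 'I_n J m) (w : word m) :
  relcoef QA g w = (relcoef Q g w)%:A.
Proof. exact: (relcoef_morph (GRing.in_alg A)). Qed.

Lemma inWP (M : lmodType A) a (z : word a -> M) :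
  inW z <-> forall g, \sum_w (relcoef Q g w)%:A *: z w = 0.
Proof.
have E g : \sum_w relcoef QA g w *: z w = \sum_w (relcoef Q g w)%:A *: z w.
  by apply: eq_bigr => w _; rewrite relcoefA.
by split=> h g; [rewrite -E | rewrite E]; apply: h.
Qed.

Lemma inW_ext (M : lmodType A) a (z z' : word a -> M) : z =1 z' -> inW z -> inW z'.
Proof. exact: inU_ext. Qed.

Lemma inW0 (M : lmodType A) a : inW (fun _ : word a => 0 : M).
Proof. exact: inU_const0. Qed.

Lemma inW_map (M M' : lmodType A) (phi : {additive M -> M'}) a (z : word a -> M) :
  (forall (c : k) p, phi (c%:A *: p) = c%:A *: phi p) ->
  inW z -> inW (fun w => phi (z w)).
Proof.
move=> hphi /inWP h; apply/inWP=> g; have := congr1 phi (h g).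
by rewrite raddf_sum raddf0; under eq_bigr do rewrite hphi.
Qed.

Section Delta.
Variable M : lmodType A.

(** The Koszul differential: the last letter of the word, stored as its first entry, is multiplied
    onto the coefficient. *)
Definition kdiff a (z : word a.+1 -> M) : word a -> M :=
  fun w => \sum_i x i *: z (i, w).

Lemma kdiff_inW a (z : word a.+1 -> M) : inW z -> inW (kdiff z).
Proof.
move=> h; apply/inWP=> g.
transitivity (\sum_i x i *: \sum_w (relcoef Q g w)%:A *: slice z i w).
  under [RHS]eq_bigr do rewrite scaler_sumr; rewrite [RHS]exchange_big.
  apply: eq_bigr => w _; rewrite /kdiff scaler_sumr; apply: eq_bigr => i _.
  by rewrite !scalerA mulr_algl mulr_algr.
by rewrite big1 // => i _; have /inWP -> := inU_slice i h; rewrite scaler0.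
Qed.

Lemma kdiff_sub a (z z' : word a.+1 -> M) w :
  kdiff (fun w => z w - z' w) w = kdiff z w - kdiff z' w.
Proof. by rewrite -sumrB; apply: eq_bigr => i _; rewrite scalerBr. Qed.

Lemma kdiff_0 a w : kdiff (fun _ : word a.+1 => 0 : M) w = 0.
Proof. by rewrite /kdiff big1 // => i _; rewrite scaler0. Qed.

Lemma kdiff_ext a (z z' : word a.+1 -> M) w : z =1 z' -> kdiff z w = kdiff z' w.
Proof. by move=> E; apply: eq_bigr => i _; rewrite E. Qed.

Lemma kdiff_sum (I : Type) (s : seq I) a (z : I -> word a.+1 -> M) w :
  kdiff (fun w => \sum_(i <- s) z i w) w = \sum_(i <- s) kdiff (z i) w.
Proof. by rewrite exchange_big; apply: eq_bigr => i _; rewrite scaler_sumr. Qed.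

End Delta.

(* Makes it possible to lift elements of W_a (x) M along surjections. *)
Lemma inW_project a : exists p : word a -> word a -> k,
  (forall (M : lmodType A) (z : word a -> M),
    inW (fun w => \sum_w' (p w w')%:A *: z w')) /\
  (forall (M : lmodType A) (z : word a -> M), inW z ->
    forall w, \sum_w' (p w w')%:A *: z w' = z w).
Proof.
have [Y EY] := exists_projector (fun (g : relgen 'I_n J a) w => relcoef Q g w).
exists (fun w w' => (w == w')%:R - \sum_g Y w g * relcoef Q g w').
split=> M z => [|/inWP hz w].
  apply/inWP=> g; under eq_bigr do rewrite scaler_sumr.
  rewrite exchange_big big1 // => w' _ /=.
  under eq_bigr do rewrite scalerA mulr_algl scalerA.
  by rewrite -scaler_suml -scaler_suml EY !scale0r.
under eq_bigr do rewrite !scalerBl; rewrite sumrB.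
rewrite (bigD1 w) //= eqxx !scale1r big1 ?addr0 => [|w' /negbTE ne]; last first.
  by rewrite eq_sym ne !scale0r.
rewrite [X in _ - X](_ : _ = 0) ?subr0 //.
transitivity (\sum_g (Y w g)%:A *: \sum_w' (relcoef Q g w')%:A *: z w').
  under [RHS]eq_bigr do rewrite scaler_sumr; rewrite [RHS]exchange_big.
  apply: eq_bigr => w' _; rewrite !scaler_suml; apply: eq_bigr => g _.
  by rewrite scalerA mulr_algl scalerA.
by rewrite big1 // => g _; rewrite hz scaler0.
Qed.

Lemma inW_lift (M M' : lmodType A) (phi : {additive M -> M'}) a (z : word a -> M') :
  (forall (c : k) p, phi (c%:A *: p) = c%:A *: phi p) ->
  inW z -> (forall w, exists p, z w = phi p) ->
  exists y : word a -> M, inW y /\ forall w, z w = phi (y w).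
Proof.
move=> hphi hz /fin_all_exists[y Ey]; have [p [h1 h2]] := inW_project a.
exists (fun w => \sum_w' (p w w')%:A *: y w'); split=> // w.
rewrite raddf_sum -[LHS](h2 _ _ hz); apply: eq_bigr => w' _.
by rewrite hphi Ey.
Qed.

Lemma kdiff_map (M M' : lmodType A) (phi : {linear M -> M'}) a (z : word a.+1 -> M) w :
  phi (kdiff z w) = kdiff (fun w => phi (z w)) w.
Proof. by rewrite linear_sum; apply: eq_bigr => i _; rewrite linearZ. Qed.

(* Exactness at W_(a+1) (x) M. *)
Definition exact_at (M : lmodType A) a : Prop :=
  forall z : word a.+1 -> M, inW z -> (forall w, kdiff z w = 0) ->
  exists y : word a.+2 -> M, inW y /\ forall w, kdiff y w = z w.

Section FreeModules.
Variable G : choiceType.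
Local Notation P := {malg A[G]}.

Lemma scale_mcoeff g (c : k) (p : P) :
  mcoeff g (c%:A *: p) = c%:A *: (mcoeff g p : A^o).
Proof. exact: mcoeffZ. Qed.

Definition coef g a (z : word a -> P) : word a -> A^o := fun w => (z w)@_g.

Lemma inW_coef a (z : word a -> P) : inW z <-> forall g, inW (coef g z).
Proof.
split=> [h g|h].
  exact: (inW_map (phi := mcoeff g : {additive P -> A^o}) (scale_mcoeff g) h).
apply/inWP=> r; apply/malgP=> g; rewrite mcoeff0 raddf_sum /=.
have /inWP/(_ r) E := h g; apply: etrans E.
by apply: eq_bigr => w _; apply: scale_mcoeff.
Qed.

Lemma coef_kdiff g a (z : word a.+1 -> P) w : (kdiff z w)@_g = kdiff (coef g z) w.
Proof. by rewrite raddf_sum; apply: eq_bigr => i _; apply: mcoeffZ. Qed.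

Lemma common_support (T : finType) (z : T -> P) :
  exists S : seq G, uniq S /\ forall t g, g \notin S -> (z t)@_g = 0.
Proof.
exists (undup (flatten [seq enum_fset (msupp (z t)) | t <- enum T])).
split=> [|t g]; first exact: undup_uniq.
rewrite mem_undup => hg; apply: mcoeff_outdom; apply: contra hg => hg.
apply/flattenP; exists (enum_fset (msupp (z t))) => //.
by apply: (map_f (fun t => enum_fset (msupp (z t)))); rewrite mem_enum.
Qed.

Lemma mcoeff_assemble (S : seq G) (c : G -> A) g : uniq S ->
  (\sum_(h <- S) << c h *g h >> : P)@_g = if g \in S then c g else 0.
Proof.
move=> uS; rewrite raddf_sum /=; under eq_bigr do rewrite mcoeffU.
case: ifPn => hg.
  rewrite (bigD1_seq g) //= eqxx big1 ?addr0 // => h /negbTE ne.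
  by rewrite ne.
rewrite big_seq big1 // => h hS; case: eqP => // E.
by rewrite -E hS in hg.
Qed.

(** A linear problem over a free module is solved one coefficient at a time. Only finitely many
    basis elements occur in [z]; elsewhere the solution is set to 0, which is why [R] has to hold at
    zero. *)
Lemma lift_coefs a b (z : word a -> P) (R : (word b -> A^o) -> (word a -> A^o) -> Prop) :
  R (fun=> 0) (fun=> 0) ->
  (forall g, exists y, inW y /\ R y (coef g z)) ->
  exists y : word b -> P, inW y /\ forall g, exists2 y', coef g y =1 y' & R y' (coef g z).
Proof.
move=> R0 /choice[Y HY]; have [S [uS hS]] := common_support z.
pose y w : P := \sum_(g <- S) << Y g w *g g >>.
have Ey g w : (y w)@_g = if g \in S then Y g w else 0 by exact: (mcoeff_assemble (fun g => Y g w)).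
exists y; split=> [|g].
  apply/inW_coef=> g; have [hY _] := HY g.
  case: (boolP (g \in S)) => hg.
    by apply: inW_ext hY => w; rewrite /coef Ey hg.
  by apply: (inW_ext _ (@inW0 A^o b)) => w; rewrite /coef Ey (negbTE hg).
case: (boolP (g \in S)) => hg.
  by exists (Y g) => [w|]; [rewrite /coef Ey hg | case: (HY g)].
exists (fun=> 0) => [w|]; first by rewrite /coef Ey (negbTE hg).
have -> // : coef g z = (fun=> 0) by apply/funext=> w; apply: hS.
Qed.

Lemma exact_free a : exact_at A^o a -> exact_at P a.
Proof.
move=> ex z hz dz.
have [||y [hy Hy]] := lift_coefs (b := a.+2) (z := z) (R := fun y z => forall w, kdiff y w = z w).
- by move=> w; apply: kdiff_0.
- move=> g; apply: ex; first by move/inW_coef: hz.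
  by move=> w; rewrite -coef_kdiff dz mcoeff0.
exists y; split=> // w; apply/malgP=> g; have [y' E E'] := Hy g.
by rewrite coef_kdiff (kdiff_ext _ E) E'.
Qed.

End FreeModules.

End Koszul.

(* Q is, up to swapping the two letters, a spanning set of the orthogonal of
   the span of f. *)
Record orthogonal_rel (k : fieldType) (n r : nat) (f : 'I_r -> 'I_n -> 'I_n -> k)
    (J : finType) (Q : J -> 'I_n -> 'I_n -> k) : Prop := OrthogonalRel {
  or_orth : forall j s, \sum_a \sum_b Q j a b * f s b a = 0;
  or_dual : exists (G : 'I_r -> 'I_n -> 'I_n -> k) (H : J -> 'I_n -> 'I_n -> k),
    forall a b a' b', ((a == a') && (b == b'))%:R
      = \sum_s f s a b * G s a' b' + \sum_j H j a b * Q j b' a'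
}.

(** * The double complex of the Koszul complex and a graded free resolution *)

Section Chase.
Variables (k : fieldType) (n r : nat) (A : cg_algebra k).
Variables (f : 'I_r -> 'I_n -> 'I_n -> k) (x : 'I_n -> A).
Hypothesis qa : quad_alg_facts f x.
Variables (J : finType) (Q : J -> 'I_n -> 'I_n -> k).
Hypothesis orth : orthogonal_rel f Q.
Local Notation word := (word 'I_n).
Local Notation inW := (inW Q).
Local Notation kdiff := (kdiff x).
Local Notation exact_at := (exact_at x Q).

Lemma orthogonal_span (M : lmodType A) (t : 'I_n -> 'I_n -> M) :
  (forall j, \sum_a \sum_b (Q j a b)%:A *: t a b = 0) ->
  exists c : 'I_r -> M, forall a b, t a b = \sum_s (f s b a)%:A *: c s.
Proof.
move=> h; have [G [H GH]] := or_dual orth.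
exists (fun s => \sum_a' \sum_b' (G s a' b')%:A *: t b' a') => a b.
transitivity (\sum_b' \sum_a' ((b == a') && (a == b'))%:R%:A *: t b' a').
  rewrite (bigD1 a) //= (bigD1 b) //= !eqxx scale1r scale1r.
  rewrite !big1 ?addr0 // => [b' /negbTE ne|a' /negbTE ne].
    by rewrite big1 // => a' _; rewrite [a == b']eq_sym ne andbF scale0r scale0r.
  by rewrite [b == a']eq_sym ne scale0r scale0r.
under eq_bigr do under eq_bigr do rewrite GH 2!scalerDl.
under eq_bigr do rewrite big_split; rewrite big_split /=.
rewrite [X in _ + X](_ : _ = 0) ?addr0.
  under [RHS]eq_bigr do rewrite scaler_sumr; rewrite [RHS]exchange_big.
  rewrite [LHS]exchange_big; apply: eq_bigr => a' _.
  under [RHS]eq_bigr do rewrite scaler_sumr; rewrite [RHS]exchange_big.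
  apply: eq_bigr => b' _; rewrite 2!scaler_suml; apply: eq_bigr => s _.
  by rewrite !scalerA mulr_algl scalerA.
transitivity (\sum_j (H j b a)%:A *: \sum_b' \sum_a' (Q j b' a')%:A *: t b' a').
  under [RHS]eq_bigr do rewrite scaler_sumr; rewrite [RHS]exchange_big.
  apply: eq_bigr => b' _.
  under [RHS]eq_bigr do rewrite scaler_sumr; rewrite [RHS]exchange_big.
  apply: eq_bigr => a' _; rewrite 2!scaler_suml; apply: eq_bigr => j _.
  by rewrite !scalerA mulr_algl scalerA.
by rewrite big1 // => j _; rewrite h scaler0.
Qed.

Lemma inW_rel (M : lmodType A) a (z : word a.+2 -> M) w : inW z ->
  exists c : 'I_r -> M, forall i j, z (i, (j, w)) = \sum_s (f s j i)%:A *: c s.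
Proof.
by case/inUSS=> _ h; apply: (orthogonal_span (t := fun i j => z (i, (j, w)))) => j; apply: h.
Qed.

Lemma kdiff_kdiff (M : lmodType A) a (z : word a.+2 -> M) w : inW z -> kdiff (kdiff z) w = 0.
Proof.
move=> /(inW_rel w)[c Ec]; rewrite /kdiff.
transitivity (\sum_s (\sum_i \sum_j f s i j *: (x i * x j)) *: c s); last first.
  by rewrite big1 // => s _; rewrite (qa_rel qa) scale0r.
under [RHS]eq_bigr do rewrite scaler_suml; rewrite [RHS]exchange_big.
apply: eq_bigr => i _; rewrite scaler_sumr.
under [RHS]eq_bigr do rewrite scaler_suml; rewrite [RHS]exchange_big.
apply: eq_bigr => j _; rewrite Ec !scaler_sumr; apply: eq_bigr => s _.
by rewrite !scalerA mulr_algr.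
Qed.

Section FreeComp.
Variables (G : choiceType) (deg : G -> nat).
Local Notation P := {malg A[G]}.

Lemma mcomp_alg j (c : k) (p : P) : mcomp deg j (c%:A *: p) = c%:A *: mcomp deg j p.
Proof. by rewrite (mcomp_scale _ _ _ (hom0_alg A c)) subn0. Qed.

Lemma inW_mcomp j a (z : word a -> P) : inW z -> inW (fun w => mcomp deg j (z w)).
Proof. exact: inW_map (mcomp_alg j). Qed.

Lemma mcomp_kdiff j a (z : word a.+1 -> P) w :
  mcomp deg j.+1 (kdiff z w) = kdiff (fun w => mcomp deg j (z w)) w.
Proof.
rewrite raddf_sum; apply: eq_bigr => i _ /=.
by rewrite (mcomp_scale _ _ _ (qa_hom qa i)) subn1.
Qed.

Lemma mcomp0_kdiff a (z : word a.+1 -> P) w : mcomp deg 0 (kdiff z w) = 0.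
Proof.
by rewrite raddf_sum big1 // => i _ /=; rewrite (mcomp_scale _ _ _ (qa_hom qa i)).
Qed.

Lemma aug_submod_kdiff (z : word 1 -> P) w : in_aug_submod (kdiff z w).
Proof.
move=> g; rewrite coef_kdiff linear_sum big1 // => i _ /=.
by apply: etrans (rmorphM (cg_aug A) (x i) _) _; rewrite /= (aug_x qa) mul0r.
Qed.

Lemma aug_submod_gen (p : P) : in_aug_submod p ->
  exists y : word 1 -> P, kdiff y tt = p.
Proof.
move=> hp.
have [||y [_ Hy]] := lift_coefs (Q := Q) (a := 0) (b := 1) (z := fun=> p)
  (R := fun y z => kdiff y tt = z tt).
- exact: kdiff_0.
- move=> g; have [y Ey] := aug0_gen qa (hp g).
  exists (fun w => y w.1); split; first exact: inU1.
  by rewrite /coef Ey.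
exists y; apply/malgP=> g; have [y' E E'] := Hy g.
by rewrite coef_kdiff (kdiff_ext _ _ E) E'.
Qed.

End FreeComp.

Section Resolution.
Variable P : graded_free_resolution A.
Local Notation Pm b := {malg A[res_gen P b]}.
Local Notation homog b := (free_mod_homog (@res_deg _ _ P b)).
Local Notation d b := (res_diff P b).

Definition cycle b : Pm b -> Prop :=
  match b with
  | 0 => fun p => res_aug P p = 0
  | b'.+1 => fun p => d b' p = 0
  end.

Lemma cycleP b (p : Pm b) : cycle p <-> exists q, p = d b q.
Proof. by case: b p => [|b] p; [apply: res_exact0 | apply: res_exact]. Qed.

Lemma lift_cycle b a (z : word a -> Pm b) : inW z -> (forall w, cycle (z w)) ->
  exists v : word a -> Pm b.+1, inW v /\ forall w, z w = d b (v w).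
Proof.
move=> hz cz; apply: (inW_lift (phi := d b)) hz _ => [c p|w].
  exact: linearZ.
exact/cycleP.
Qed.

Lemma inW_diff b a (z : word a -> Pm b.+1) : inW z -> inW (fun w => d b (z w)).
Proof. by apply: inW_map => c p; apply: linearZ. Qed.

(** Let N_a be the cokernel of W_(a+1) (x) A -> W_a (x) A, so that N_0 = k. The condition says that
    [z] represents a cycle of N_a (x)_A P. Accordingly [tor_zero a b e] is the vanishing of
    Tor_b(N_a, k) in degree e, where the letters of W_a do not count. *)
Definition vcond b a : (word a -> Pm b) -> Prop :=
  match b with
  | 0 => fun _ => True
  | b'.+1 => fun z => exists z' : word a.+1 -> Pm b', inW z' /\ forall w, d b' (z w) = kdiff z' w
  end.

(* Vanishing of the homology of P in internal degree e modulo the image of kdiff,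
   with coefficients in W_a. *)
Definition tor_zero a b e : Prop :=
  forall z : word a -> Pm b, (forall w, homog b e (z w)) -> inW z -> vcond z ->
  exists (u : word a.+1 -> Pm b) (v : word a -> Pm b.+1),
    [/\ inW u, inW v & forall w, z w = kdiff u w + d b (v w)].

Lemma tor_zero_cycle a b (z : word a -> Pm b) : inW z ->
  (forall w, cycle (z w)) ->
  exists (u : word a.+1 -> Pm b) (v : word a -> Pm b.+1),
    [/\ inW u, inW v & forall w, z w = kdiff u w + d b (v w)].
Proof.
move=> hz cz; have [v [hv Ev]] := lift_cycle hz cz.
exists (fun=> 0), v; split=> [||w] //; first exact: inW0.
by rewrite kdiff_0 add0r.
Qed.

(** N_a is generated in degree 0. *)
Lemma tor_zero0 a e : e != 0%N -> tor_zero a 0 e.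
Proof.
move=> e0 z hz iz _; apply: tor_zero_cycle => // w.
by apply: res_aug_homog (hz w); rewrite lt0n.
Qed.

Lemma diff_mcomp b j p :
  d b (mcomp (@res_deg _ _ P b.+1) j p) = mcomp (@res_deg _ _ P b) j (d b p).
Proof. by apply: homog_map_mcomp => j' p'; apply: res_diff_homog. Qed.

Lemma cycle_diff b p : cycle (d b p).
Proof. by apply/cycleP; exists p. Qed.

(** By exactness N_(a+1) embeds into W_a (x) A, so being a cycle can be tested after [kdiff]. *)
Lemma vcond_exact a b (z : word a.+1 -> Pm b) :
  exact_at A^o a -> inW z -> (forall w, cycle (kdiff z w)) -> vcond z.
Proof.
case: b z => [|b] z //= ex iz cz.
have [|y [iy Ey]] := exact_free ex (inW_diff iz); first by move=> w; rewrite -kdiff_map cz.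
by exists y; split=> // w; rewrite Ey.
Qed.

Lemma tor_zero_up a b e :
  (e != 0%N -> exact_at A^o a /\ tor_zero a.+1 b e.-1) -> tor_zero a b.+1 e.
Proof.
move=> F z hz iz [z0 [iz0 Ez0]]; case: e F hz => [|e] F hz.
  apply: tor_zero_cycle => // w.
  by rewrite /cycle -(mcomp_id (res_diff_homog (hz w))) Ez0 mcomp0_kdiff.
have {F} [ex F] := F isT.
pose z1 w := mcomp (@res_deg _ _ P b) e (z0 w).
have iz1 : inW z1 by apply: inW_mcomp.
have Ez1 w : d b (z w) = kdiff z1 w.
  by rewrite -mcomp_kdiff -Ez0 mcomp_id //; apply: res_diff_homog.
have [||u [v [iu iv E]]] := F z1 _ iz1.
- by move=> w; apply: mcomp_homog.
- by apply: vcond_exact => // w; rewrite -Ez1; apply: cycle_diff.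
have [||v' [iv' Ev']] := @lift_cycle b.+1 a (fun w => z w - kdiff v w).
- by apply: inU_sub => //; apply: kdiff_inW.
- move=> w; rewrite /cycle linearB Ez1 kdiff_map -kdiff_sub.
  by rewrite (kdiff_ext _ _ (z' := kdiff u)) ?kdiff_kdiff // => w'; rewrite E addrK.
by exists v, v'; split=> // w; rewrite -Ev' addrC subrK.
Qed.

Lemma tor_zero_exact a b e :
  (forall a, exact_at A^o a) -> e != b -> tor_zero a b e.
Proof.
move=> ex; elim: b a e => [|b IH] a e eb; first exact: tor_zero0.
by apply: tor_zero_up => e0; split=> //; apply: IH; case: e e0 eb.
Qed.

(** The same shift in the opposite direction: [z] corresponds to [y] with d y = kdiff z. *)
Lemma tor_zero_down a b e :
  exact_at A^o a -> tor_zero a b.+1 e.+1 -> tor_zero a.+1 b e.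
Proof.
move=> ex F z hz iz cz.
have [|y0 [iy0 Ey0]] := lift_cycle (kdiff_inW x iz).
  move=> w; case: b F z hz iz cz => [|b] F z hz iz /= cz.
    by rewrite raddf_sum big1 // => i _ /=; rewrite res_augZ (aug_x qa) mul0r.
  by case: cz => z' [iz' Ez']; rewrite kdiff_map (kdiff_ext _ _ Ez'); apply: kdiff_kdiff.
pose y w := mcomp (@res_deg _ _ P b.+1) e.+1 (y0 w).
have iy : inW y by apply: inW_mcomp.
have Ey w : kdiff z w = d b (y w).
  rewrite diff_mcomp -Ey0 mcomp_kdiff; apply: kdiff_ext => w'.
  by rewrite mcomp_id.
have [||u [v [iu iv E]]] := F y _ iy.
- by move=> w; apply: mcomp_homog.
- by exists z; split=> // w; rewrite Ey.
have [||t [it Et]] := exact_free ex (z := fun w => z w - d b (u w)).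
- by apply: inU_sub => //; apply: inW_diff.
- move=> w; rewrite kdiff_sub Ey -kdiff_map -linearB E addrAC subrr add0r.
  by have /cycleP : exists q, d b.+1 (v w) = d b.+1 q by exists (v w).
by exists t, u; split=> // w; rewrite Et subrK.
Qed.

Lemma tor_vanishes_zero b e : tor_vanishes A b e -> tor_zero 0 b e.
Proof.
move=> tv z hz iz cz.
have [|q hq Hq] := tv P (z tt) (hz tt).
  case: b z hz iz cz {tv} => [|b] z hz iz //= [z' [_ ->]].
  exact: aug_submod_kdiff.
have [u Eu] := aug_submod_gen Hq.
exists u, (fun=> q); split=> [||[]]; [exact: inU1 | exact: inU0 |].
by rewrite Eu subrK.
Qed.

End Resolution.

Lemma exact_koszul : (forall a, exact_at A^o a) -> koszul A.
Proof.
move=> ex i j ij P p hp cp.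
have ji : j != i by rewrite eq_sym.
have [|||u [v [iu iv E]]] := tor_zero_exact ex ji (a := 0) (P := P) (z := fun=> p).
- by [].
- exact: inU0.
- case: i p hp cp {ij ji} => [|i] p hp //= /aug_submod_gen[y Ey].
  by exists y; split=> [|[]]; [exact: inU1 | rewrite Ey].
(* The chase yields a [v] that may be inhomogeneous; its component of degree j suffices because A_+
   P is a graded submodule. *)
exists (mcomp (@res_deg _ _ P i.+1) j (v tt)); first exact: mcomp_homog.
rewrite diff_mcomp -{1}(mcomp_id hp) -raddfB /= (E tt) addrK.
move=> g; rewrite mcoeff_mcomp; case: ifP => _; last exact: linear0.
by rewrite aug_comp; case: ifP => // _; apply: aug_submod_kdiff.
Qed.

End Chase.

(** * From Koszulness to exactness of the Koszul complex *)

Section KoszulExact.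
Variables (k : fieldType) (n r : nat) (A : cg_algebra k).
Variables (f : 'I_r -> 'I_n -> 'I_n -> k) (x : 'I_n -> A).
Hypothesis qa : quad_alg_facts f x.
Variables (J : finType) (Q : J -> 'I_n -> 'I_n -> k).
Hypothesis orth : orthogonal_rel f Q.
Local Notation word := (word 'I_n).
Local Notation inW := (inW Q).
Local Notation kdiff := (kdiff x).
Local Notation exact_at := (exact_at x Q).

Definition exact_deg a e : Prop :=
  forall z : word a.+1 -> A^o, (forall w, cg_hom e (z w)) -> inW z ->
  (forall w, kdiff z w = 0) ->
  exists y : word a.+2 -> A^o, inW y /\ forall w, kdiff y w = z w.

Lemma scale_alg (c : k) (p : A^o) : (c%:A : A) *: p = c *: (p : A).
Proof. exact: (mulr_algl c (p : A)). Qed.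

Lemma hcomp_alg e (c : k) (p : A) : hcomp e (c%:A * p) = c%:A * hcomp e p.
Proof. by rewrite !mulr_algl linearZ. Qed.

Lemma exact_graded a : (forall e, exact_deg a e) -> exact_at A^o a.
Proof.
move=> ex z iz dz.
have /choice[N HN] := fun w => hcomp_sumP (z w : A).
have cz e : inW (fun w => hcomp e (z w : A) : A^o).
  apply: (inW_map (phi := hcomp e : {additive A^o -> A^o})) iz => c p.
  exact: hcomp_alg.
have dcz e w : kdiff (fun w => hcomp e (z w : A) : A^o) w = 0.
  have /(congr1 (hcomp e.+1)) := dz w; rewrite linear0 => E; apply: etrans E.
  exact: esym (hcomp_gen qa e (fun i => z (i, w))).
have /choice[y Hy] := fun e => ex e _ (fun w => hcomp_hom e (z w : A)) (cz e) (dcz e).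
exists (fun w => \sum_(e < \sum_w N w) y e w); split.
  by apply: inU_sum => e; case: (Hy e).
move=> w; rewrite kdiff_sum; have [_ E] := HN w.
have le : (N w <= \sum_w N w)%N by rewrite (bigD1 w) //= leq_addr.
rewrite [RHS](E _ le).
by apply: eq_bigr => e _; case: (Hy e).
Qed.

Lemma x_comb (a : A) : cg_hom 1 a -> exists t : 'I_n -> k, a = \sum_i t i *: x i.
Proof.
case/(hom_gen qa)=> y [hy ->]; exists (fun i => cg_aug A (y i)).
by apply: eq_bigr => i _; rewrite {1}(hom0_aug (hy i)) mulr_algr.
Qed.

Lemma inW_comb m (I : finType) (b : I -> A) (t : word m -> I -> k) :
  (forall i, inU Q (fun w => t w i : k^o)) ->
  inW (fun w => \sum_i t w i *: b i : A^o).
Proof.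
move=> h; apply/inWP=> g.
transitivity (\sum_i (\sum_w relcoef Q g w * t w i) *: b i : A).
  under [RHS]eq_bigr do rewrite scaler_suml; rewrite [RHS]exchange_big.
  apply: eq_bigr => w _; rewrite scale_alg scaler_sumr.
  by apply: eq_bigr => i _; rewrite scalerA.
rewrite big1 // => i _; have E := h i g.
rewrite (_ : \sum_w _ = 0) ?scale0r //; exact: E.
Qed.

Lemma inW_comb_indep m (I : finType) (b : I -> A) (t : word m -> I -> k) :
  (forall c : I -> k, \sum_i c i *: b i = 0 -> forall i, c i = 0) ->
  inW (fun w => \sum_i t w i *: b i : A^o) ->
  forall i, inU Q (fun w => t w i : k^o).
Proof.
move=> ind /inWP h i g; move: i; apply: ind.
have E := h g; apply: etrans E; under eq_bigr do rewrite scaler_suml.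
rewrite exchange_big; apply: eq_bigr => w _; rewrite scale_alg scaler_sumr.
by apply: eq_bigr => i _; rewrite scalerA.
Qed.

(** Independence of the x_i makes [kdiff] injective on scalar coefficients. *)
Lemma exact_deg0 a : exact_deg a 0.
Proof.
move=> z hz iz dz; exists (fun=> 0); split; first exact: inW0.
case=> i w; rewrite kdiff_0 (hom0_aug (hz (i, w))) /=.
have E : forall i, cg_aug A (z (i, w)) = 0.
  apply: (x_indep qa); apply: etrans (dz w); apply: eq_bigr => j _.
  by rewrite [z (j, w) in RHS](hom0_aug (hz (j, w))) -[RHS]/(_ * _) mulr_algr.
by rewrite E scale0r.
Qed.

(** Appending the letter of the coefficient to the word gives an element of W_(a+1) V. That [kdiff]
    kills it means, by [quad_indep], that its last two letters lie in R, and these two conditions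
    define W_(a+2). *)
Lemma exact_deg1 a : exact_deg a 1.
Proof.
move=> z hz iz dz.
have /fin_all_exists[t Et] := fun w => x_comb (hz w).
have it : forall i, inU Q (fun w => t w i : k^o).
  by apply: inW_comb_indep (x_indep qa) _; apply: inW_ext iz => w; rewrite Et.
exists (fun w => (t w.2 w.1)%:A); split; last first.
  by move=> w; rewrite Et; apply: eq_bigr => i _; rewrite -[LHS]/(_ * _) mulr_algr.
have inA1 m (tau : word m -> k^o) : inU Q tau -> inW (fun w => (tau w)%:A : A^o).
  move=> h; have := @inW_comb m unit (fun=> 1) (fun w _ => tau w) (fun=> h).
  by apply: inW_ext => w; rewrite big_const cardE enumT unlock /= addr0.
apply/inUSS; split=> [i|j u]; first exact: inA1 _ _ (it i).
have [c Ec] : exists c : 'I_r -> k, forall b i, t (b, u) i = \sum_s c s * f s b i.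
  apply: (quad_indep qa (t := fun b i => t (b, u) i)); apply: etrans (dz u).
  apply: eq_bigr => b _; rewrite Et -[RHS]/(_ * _) mulr_sumr.
  by apply: eq_bigr => i _; rewrite scalerAr.
transitivity ((\sum_i \sum_b Q j i b * t (b, u) i)%:A : A).
  rewrite scaler_suml; apply: eq_bigr => i _; rewrite scaler_suml.
  by apply: eq_bigr => b _; rewrite scale_alg scalerA.
rewrite (_ : \sum_i _ = 0) ?scale0r //.
transitivity (\sum_s c s * \sum_i \sum_b Q j i b * f s b i); last first.
  by rewrite big1 // => s _; rewrite (or_orth orth) mulr0.
under [RHS]eq_bigr do rewrite mulr_sumr; rewrite [RHS]exchange_big.
apply: eq_bigr => i _; under [RHS]eq_bigr do rewrite mulr_sumr; rewrite [RHS]exchange_big.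
by apply: eq_bigr => b _; rewrite Ec mulr_sumr; apply: eq_bigr => s _; rewrite mulrCA.
Qed.

(* A resolution with P_0 = A; the map T is the identification of P_0 with A. *)
Lemma exists_resolution : exists (P : graded_free_resolution A)
    (T : {linear {malg A[res_gen P 0]} -> A^o}) (g0 : {malg A[res_gen P 0]}),
  [/\ forall j p, free_mod_homog (@res_deg _ _ P 0) j p -> cg_hom j (T p),
      forall p, res_aug P p = cg_aug A (T p),
      free_mod_homog (@res_deg _ _ P 0) 0 g0 & T g0 = 1].
Proof.
pose t (p : {malg A[unit]}) : A^o := p@_tt.
have t_lin : linear t by move=> a p q; rewrite /t mcoeffD mcoeffZ.
pose T : {linear {malg A[unit]} -> A^o} := HB.pack t (GRing.isLinear.Build _ _ _ _ _ t_lin).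
exists (syzygy_resolution A), T, (<< 1 *g tt >> : {malg A[unit]}); split=> //.
- by move=> j p /(_ tt); rewrite leq0n subn0.
- by move=> g; rewrite mcoeffU; case: g; apply: cg_hom1.
- exact: mcoeffUU.
Qed.

Section Resolution.
Variable P : graded_free_resolution A.
Local Notation Pm b := {malg A[res_gen P b]}.
Local Notation deg b := (@res_deg _ _ P b).
Variables (T : {linear Pm 0 -> A^o}) (g0 : Pm 0).
Hypothesis T_homog : forall j p, free_mod_homog (deg 0) j p -> cg_hom j (T p).
Hypothesis T_aug : forall p, res_aug P p = cg_aug A (T p).
Hypothesis g0_homog : free_mod_homog (deg 0) 0 g0.
Hypothesis T_g0 : T g0 = 1.

Lemma expand_support (G : choiceType) (p : {malg A[G]}) (S : seq G) : uniq S ->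
  (forall g, g \notin S -> p@_g = 0) -> p = \sum_(g <- S) p@_g *: << g >>.
Proof.
move=> uS hS; apply/malgP=> g.
transitivity ((\sum_(h <- S) << p@_h *g h >>)@_g).
  by rewrite (mcoeff_assemble (fun h => p@_h)) //; case: ifPn => // /hS.
congr (mcoeff g _); apply: eq_bigr => h _; apply/malgP=> h'.
by rewrite mcoeffZ !mcoeffU; case: (h == h'); rewrite ?mulr1 ?mulr0.
Qed.

Lemma homogU (G : choiceType) (dg : G -> nat) (g : G) (a : A) j :
  cg_hom j a -> free_mod_homog dg (j + dg g) << a *g g >>.
Proof.
move=> ha h; rewrite mcoeffU; case: eqP => [<-|_].
  by rewrite leq_addl addnK.
by case: ifP => // _; apply: cg_hom0.
Qed.

Lemma homogZ (G : choiceType) (dg : G -> nat) i j (a : A) (p : {malg A[G]}) :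
  cg_hom i a -> free_mod_homog dg j p -> free_mod_homog dg (i + j) (a *: p).
Proof.
move=> ha hp g; rewrite mcoeffZ; have := hp g; case: (leqP (dg g) j) => le h.
  by rewrite (leq_trans le (leq_addl _ _)) -addnBA //; apply: cg_homM.
by rewrite h mulr0; case: ifP => // _; apply: cg_hom0.
Qed.

(** Tor_2(N_a, k) vanishes in degree e+1, so the lift [z1] of [z] to P_1 can be corrected by a
    boundary to an [h] with kdiff h = 0. Each coefficient of [h] at a generator of positive degree
    has degree below e and is a [kdiff] by induction; mapping back to A shows that [z] is one. *)
Lemma exact_deg_step a e : (1 < e)%N ->
  (forall e', (e' < e)%N -> exact_deg a e') ->
  tor_zero x Q P a 2 e.+1 -> exact_deg a e.
Proof.
move=> e1 IH F z hz iz dz.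
pose z0 w : Pm 0 := (z w : A) *: g0.
have Tz0 w : T (z0 w) = z w by rewrite linearZ T_g0; apply: mulr1.
have iz0 : inW z0.
  pose sc (a : A^o) : Pm 0 := (a : A) *: g0.
  have sc_add : additive sc by move=> c b; apply: scalerBl.
  pose phi : {additive A^o -> Pm 0} := HB.pack sc (GRing.isAdditive.Build _ _ sc sc_add).
  have phi_alg (c : k) p : phi (c%:A *: p) = c%:A *: phi p by exact: esym (scalerA _ _ _).
  exact: inW_map phi_alg iz.
have dz0 w : kdiff z0 w = 0.
  rewrite -(scale0r g0) -(dz w) /kdiff scaler_suml.
  by apply: eq_bigr => i _; apply: scalerA.
have cz0 w : cycle (z0 w).
  by rewrite /cycle T_aug Tz0; apply: cg_aug_pos (hz w); apply: ltnW.
have [z1 [iz1 Ez1]] := lift_cycle iz0 cz0.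
pose z1e w := mcomp (deg 1) e (z1 w).
have Ez1e w : z0 w = res_diff P 0 (z1e w).
  rewrite diff_mcomp -Ez1 mcomp_id //.
  by rewrite -[e]addn0; apply: homogZ.
have iz1e : inW z1e by apply: inW_mcomp.
have [|y0 [iy0 Ey0]] := lift_cycle (b := 1) (kdiff_inW x iz1e).
  by move=> w; rewrite /cycle kdiff_map; apply: etrans (dz0 w);
     apply: kdiff_ext => w'; rewrite -Ez1e.
pose y w := mcomp (deg 2) e.+1 (y0 w).
have iy : inW y by apply: inW_mcomp.
have Ey w : kdiff z1e w = res_diff P 1 (y w).
  rewrite diff_mcomp -Ey0 (mcomp_kdiff qa); apply: kdiff_ext => w'.
  by rewrite mcomp_id //; apply: mcomp_homog.
have [||u [v [iu iv E]]] := F y _ iy.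
- by move=> w; apply: mcomp_homog.
- by exists z1e; split=> // w; rewrite Ey.
(* Of [u] only the component of degree e is used, which makes [h] homogeneous. *)
pose h w := z1e w - res_diff P 1 (mcomp (deg 2) e (u w)).
have ih : inW h by apply: inU_sub => //; apply: inW_diff; apply: inW_mcomp.
have hh w : free_mod_homog (deg 1) e (h w).
  have -> : h w = mcomp (deg 1) e (z1 w - res_diff P 1 (u w)).
    by rewrite raddfB /= -diff_mcomp.
  exact: mcomp_homog.
have dh w : kdiff h w = 0.
  have -> : h = (fun w => mcomp (deg 1) e (z1e w - res_diff P 1 (u w))).
    apply/funext=> w'; rewrite raddfB /= -diff_mcomp (mcomp_id (mcomp_homog _ _ _)) //.
  rewrite -(mcomp_kdiff qa) kdiff_sub Ey -kdiff_map -linearB E addrAC subrr add0r.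
  have : cycle (b := 2) (res_diff P 2 (v w)) by apply: cycle_diff.
  by move=> /= ->; rewrite raddf0.
have Eh w : z0 w = res_diff P 0 (h w).
  rewrite linearB -Ez1e.
  have /= -> : cycle (b := 1) (res_diff P 1 (mcomp (deg 2) e (u w))) by apply: cycle_diff.
  by rewrite subr0.
pose t g : A := T (res_diff P 0 << g >>).
have ht g : cg_hom (deg 1 g) (t g).
  apply/T_homog/res_diff_homog.
  by have := @homogU _ (deg 1) g _ _ (cg_hom1 A); rewrite add0n.
(* A generator of degree 0 would leave e unchanged and block the induction, but its image in A is a
   constant of augmentation 0. *)
have t0 g : deg 1 g = 0%N -> t g = 0.
  move=> dg; have := ht g; rewrite dg => /hom0_aug ->.
  have := cycle_diff (b := 0) << g >>.
  by rewrite /cycle T_aug -/(t g) => ->; rewrite scale0r.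
have [S [uS hS]] := common_support h.
have Y_ g : exists Y : word a.+2 -> A^o, inW Y /\
    forall w, (kdiff Y w : A) * t g = (h w)@_g * t g.
  have [dg|dg] := posnP (deg 1 g).
    by exists (fun=> 0); split=> [|w]; [apply: inW0 | rewrite t0 // !mulr0].
  case: (leqP (deg 1 g) e) => le; last first.
    exists (fun=> 0); split=> [|w]; first exact: inW0.
    by have := hh w g; rewrite leqNgt le /= => ->; rewrite kdiff_0.
  have [||||Y [iY EY]] := IH (e - deg 1 g)%N _ (coef g h).
  - by lia.
  - by move=> w; have := hh w g; rewrite le.
  - by move/inW_coef: ih.
  - by move=> w; rewrite -coef_kdiff dh mcoeff0.
  by exists Y; split=> // w; rewrite EY.
have {Y_} /choice[Y HY] := Y_.
exists (fun w => \sum_(g <- S) Y g w * t g); split.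
  apply: inU_sum => g; case: (HY g) => iY _.
  pose mr (a : A^o) : A^o := (a : A) * t g.
  have mr_add : additive mr by move=> c b; apply: mulrBl.
  pose phi : {additive A^o -> A^o} := HB.pack mr (GRing.isAdditive.Build _ _ mr mr_add).
  have phi_alg (c : k) p : phi (c%:A *: p) = c%:A *: phi p by exact: esym (mulrA _ _ _).
  exact: inW_map phi_alg iY.
move=> w; rewrite kdiff_sum -Tz0 Eh (expand_support uS (fun g => hS w g)).
rewrite 2!linear_sum; apply: eq_bigr => g _ /=.
case: (HY g) => _ E'. rewrite 2!linearZ; refine (etrans _ (E' w)).
by rewrite /kdiff mulr_suml; apply: eq_bigr => i _; apply: mulrA.
Qed.

End Resolution.

(** Induction on a: exactness at the earlier places carries the vanishing of Tor from N_0 = k over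
    to N_a, where Tor_2 in degree e+1 is zero because e+1 differs from 2. The inner induction on e
    then gives exactness at a. *)
Lemma koszul_exact : koszul A -> forall a, exact_at A^o a.
Proof.
have [P [T [g0 [T_homog T_aug g0_homog T_g0]]]] := exists_resolution.
move=> ks; elim/ltn_ind => a IH.
have F c b e : (c <= a)%N -> e != b -> tor_zero x Q P c b e.
  elim: c b e => [|c IHc] b e le eb.
    by apply: (tor_vanishes_zero qa); apply: ks; rewrite eq_sym.
  by apply: (tor_zero_down qa orth); [apply: IH | apply: IHc => //; apply: ltnW].
apply: exact_graded; elim/ltn_ind => e IHe.
case: e IHe => [|[|e]] IHe; [exact: exact_deg0 | exact: exact_deg1 |].
by apply: (exact_deg_step T_homog T_aug g0_homog T_g0) => //; apply: F.
Qed.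

End KoszulExact.

(** * Koszulness for few and for many relations *)

Section Pairing.
Variables (k : fieldType) (n r : nat) (A : cg_algebra k).
Variables (f : 'I_r -> 'I_n -> 'I_n -> k) (x : 'I_n -> A).
Hypothesis qa : quad_alg_facts f x.
Local Notation word := (word 'I_n).

Fixpoint monom m : word m -> A :=
  match m with
  | 0 => fun _ => 1
  | m'.+1 => fun w => x w.1 * monom w.2
  end.

Definition eval m (v : word m -> k) : A := \sum_w v w *: monom w.

Lemma eval_cons m (v : word m.+1 -> k) :
  eval v = \sum_i x i * eval (slice v i).
Proof.
rewrite /eval sum_word; apply: eq_bigr => i _; rewrite mulr_sumr.
by apply: eq_bigr => w _; rewrite scalerAr.
Qed.

Lemma eval_hom m (v : word m -> k) : cg_hom m (eval v).
Proof.
elim: m v => [|m IH] v.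
  by apply: hom_sum => w _; apply/homZ/cg_hom1.
rewrite eval_cons; apply: hom_sum => i _.
by rewrite -add1n; apply: cg_homM; [apply: (qa_hom qa) | apply: IH].
Qed.

Lemma eval_surj m (a : A) : cg_hom m a -> exists v : word m -> k, a = eval v.
Proof.
elim: m a => [|m IH] a.
  move=> /hom0_aug ->; exists (fun=> cg_aug A a).
  by rewrite /eval sum_word0.
case/(hom_gen qa)=> y [hy ->]; have /fin_all_exists[v Ev] := fun i => IH _ (hy i).
exists (fun w => v w.1 w.2); rewrite eval_cons.
by apply: eq_bigr => i _; rewrite Ev.
Qed.

Lemma eval_sub m (v v' : word m -> k) :
  eval (fun w => v w - v' w) = eval v - eval v'.
Proof. by rewrite -sumrB; apply: eq_bigr => w _; rewrite scalerBl. Qed.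

Lemma eval_comb m (I : finType) (c : I -> k) (v : I -> word m -> k) :
  eval (fun w => \sum_i c i * v i w) = \sum_i c i *: eval (v i).
Proof.
under [RHS]eq_bigr do rewrite scaler_sumr; rewrite [RHS]exchange_big.
apply: eq_bigr => w _; rewrite scaler_suml.
by apply: eq_bigr => i _; rewrite scalerA.
Qed.

Lemma eval_rel m (a : 'I_n) (u : 'I_r -> word m -> k) :
  eval (fun w : word m.+1 => \sum_s f s a w.1 * u s w.2)
  = \sum_s \sum_b f s a b *: (x b * eval (u s)).
Proof.
rewrite eval_cons exchange_big; apply: eq_bigr => b _.
rewrite [eval _](eval_comb (fun s => f s a b) u) mulr_sumr.
by apply: eq_bigr => s _; rewrite scalerAr.
Qed.

Lemma inU_monom m : inU f (@monom m).
Proof.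
elim: m => [|[|m] IH]; [exact: inU0 | exact: inU1 |].
apply/inUSS; split=> [i g|s w].
  transitivity (x i * \sum_w relcoef f g w *: monom w); last by rewrite IH mulr0.
  by rewrite mulr_sumr; apply: eq_bigr => w _; rewrite scalerAr.
transitivity ((\sum_i \sum_j f s i j *: (x i * x j)) * monom w); last first.
  by rewrite (qa_rel qa) mul0r.
rewrite mulr_suml; apply: eq_bigr => i _; rewrite mulr_suml; apply: eq_bigr => j _.
by rewrite -scalerAl -mulrA.
Qed.

(* U_m is the dual of A_m. *)
Lemma eval0_pair m (v : word m -> k) : eval v = 0 ->
  forall c : word m -> k^o, inU f c -> \sum_w v w * c w = 0.
Proof.
elim: m v => [|[|m] IH] v Ev c hc.
- move: Ev; rewrite /eval => Ev; rewrite big1 // => -[] _.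
  have : (v tt)%:A = 0 :> A.
    by apply: etrans Ev; rewrite sum_word0.
  by move/(congr1 (cg_aug A)); rewrite aug_alg linear0 => ->; rewrite mul0r.
- rewrite big1 // => -[i []] _.
  rewrite (x_indep qa (c := fun i => v (i, tt))) ?mul0r //.
  apply: etrans Ev; rewrite eval_cons; apply: eq_bigr => j _.
  by rewrite /eval sum_word0 /= mulr_algr.
move: Ev; rewrite eval_cons => /(qa_syz qa)[u0 Eu].
have /fin_all_exists[u Hu] := fun s => eval_surj (hcomp_hom m (u0 s)).
(* By [qa_syz] each slice of [v] agrees in A with a combination of relations; the difference
   evaluates to 0 and has shorter words. *)
have E i : \sum_(w : word m.+1) (v (i, w) - \sum_s f s i w.1 * u s w.2) * slice c i w = 0.
  apply: IH (inU_slice i hc); rewrite eval_sub eval_rel -/(slice v i).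
  rewrite -(hcomp_id (eval_hom (slice v i))) Eu linear_sum; apply/eqP.
  rewrite subr_eq0; apply/eqP; apply: eq_bigr => s _; rewrite linear_sum.
  apply: eq_bigr => b _ /=.
  by rewrite linearZ /= (hcomp_mull _ _ (qa_hom qa b)) /= subn1 /= Hu.
have : \sum_i \sum_(w : word m.+1) (v (i, w) - \sum_s f s i w.1 * u s w.2) * slice c i w = 0.
  by rewrite big1.
under eq_bigr do under eq_bigr do rewrite mulrBl.
under eq_bigr do rewrite sumrB.
rewrite sumrB sum_word => /eqP; rewrite subr_eq0 => /eqP ->.
transitivity (\sum_s \sum_w u s w * \sum_i \sum_j f s i j * c (i, (j, w))); last first.
  have /inUSS[_ h] := hc; rewrite big1 // => s _; rewrite big1 // => w _.
  by have E' := h s w; rewrite (_ : \sum_i _ = 0) ?mulr0 //; exact: E'.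
under eq_bigr do rewrite sum_word.
under [RHS]eq_bigr do under eq_bigr do rewrite mulr_sumr.
under [RHS]eq_bigr do rewrite exchange_big.
rewrite [RHS]exchange_big; apply: eq_bigr => i _.
under [RHS]eq_bigr do under eq_bigr do rewrite mulr_sumr.
under [RHS]eq_bigr do rewrite exchange_big.
rewrite [RHS]exchange_big; apply: eq_bigr => j _.
rewrite [RHS]exchange_big; apply: eq_bigr => w _.
rewrite mulr_suml; apply: eq_bigr => s _ /=; rewrite /slice /=; ring.
Qed.

(** If [v] were outside the span of the relations of degree m, a functional separating it from them
    would lie in U_m and pair nontrivially with [v]. *)
Lemma pair_eval0 m (v : word m -> k) :
  (forall c : word m -> k^o, inU f c -> \sum_w v w * c w = 0) -> eval v = 0.
Proof.
move=> h.
pose t (a : {ffun relgen 'I_n 'I_r m -> k^o}) : {ffun word m -> k^o} :=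
  [ffun w => \sum_g a g * relcoef f g w].
have t_lin : linear t.
  move=> c a b; apply/ffunP=> w; rewrite !ffunE scaler_sumr -big_split /=.
  by apply: eq_bigr => g _; rewrite !ffunE mulrDl -mulrA.
pose T : {linear {ffun relgen 'I_n 'I_r m -> k^o} -> {ffun word m -> k^o}} :=
  HB.pack t (GRing.isLinear.Build _ _ _ _ t t_lin).
case: (boolP ([ffun w => v w] \in limg (linfun T))) => [/memv_imgP[a _]|/separating_functional[l [l0 lv]]].
  rewrite lfunE => /ffunP E.
  have -> : eval v = eval (fun w => \sum_g a g * relcoef f g w).
    by apply: eq_bigr => w _; have := E w; rewrite !ffunE => ->.
  rewrite eval_comb big1 // => g _; have := @inU_monom m g.
  by rewrite /eval => ->; rewrite scaler0.
case/eqP: lv; rewrite -[RHS](h l); first by apply: eq_bigr => w _; rewrite ffunE mulrC.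
move=> g; pose e : {ffun relgen 'I_n 'I_r m -> k^o} := [ffun g' => (g == g')%:R].
have := l0 (linfun T e) (memv_img _ (memvf e)) => E; apply: etrans E.
apply: eq_bigr => w _; rewrite lfunE ffunE /= (bigD1 g) //= ffunE eqxx mul1r.
rewrite big1 ?addr0 => [|g' /negbTE ne]; last by rewrite ffunE eq_sym ne mul0r.
exact: mulrC.
Qed.
End Pairing.

Section FewRelations.
Variables (k : fieldType) (n r : nat) (A : cg_algebra k).
Variables (f : 'I_r -> 'I_n -> 'I_n -> k) (x : 'I_n -> A).
Hypothesis qa : quad_alg_facts f x.
Local Notation word := (word 'I_n).

(* Injectivity of R (x) A -> V (x) A. *)
Definition rel_free : Prop := forall u : 'I_r -> A,
  (forall i, \sum_s \sum_j f s i j *: (x j * u s) = 0) -> forall s, u s = 0.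

Lemma surj_rel_free : (forall m, surj f m) -> rel_free.
Proof.
move=> sf u Eu s0; have [N [_ E]] := hcomp_sumP (u s0); rewrite (E N) {E}//.
apply: big1 => /= -[m _] _ /=.
have {Eu} Eu i : \sum_s \sum_j f s i j *: (x j * hcomp m (u s)) = 0.
  have /(congr1 (hcomp m.+1)) := Eu i; rewrite linear0 => E; apply: etrans E.
  rewrite linear_sum; apply: eq_bigr => s _; rewrite linear_sum; apply: eq_bigr => j _ /=.
  by rewrite linearZ /= (hcomp_mull _ _ (qa_hom qa j)) /= subn1.
have /fin_all_exists[v Hv] := fun s => eval_surj qa (hcomp_hom m (u s)).
rewrite Hv; apply: (pair_eval0 qa) => c hc.
(* An element [c] of U_m, placed at the index [s0], is lifted along the surjection; the pairing with
   [c] then moves over to the vanishing sums. *)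
have [|C [hC EC]] := sf m (fun s w => if s == s0 then c w else 0).
  by move=> s; case: eqP => _ //; apply: inU_const0.
have E i : \sum_(w : word m.+1) (\sum_s f s i w.1 * v s w.2) * C i w = 0.
  apply: (eval0_pair qa) (hC i); rewrite eval_rel; apply: etrans (Eu i).
  by apply: eq_bigr => s _; apply: eq_bigr => j _; rewrite Hv.
have : \sum_s \sum_w v s w * (if s == s0 then c w else 0) = 0.
  transitivity (\sum_i \sum_(w : word m.+1) (\sum_s f s i w.1 * v s w.2) * C i w); last first.
    by rewrite big1.
  under eq_bigr do under eq_bigr do rewrite -EC mulr_sumr.
  under eq_bigr do rewrite exchange_big.
  rewrite exchange_big; apply: eq_bigr => i _; rewrite sum_word.
  under eq_bigr do under eq_bigr do rewrite mulr_sumr.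
  under eq_bigr do rewrite exchange_big.
  rewrite exchange_big; apply: eq_bigr => j _; rewrite exchange_big; apply: eq_bigr => w _.
  by rewrite mulr_suml; apply: eq_bigr => s _ /=; rewrite -[_ *: _]/(_ * _); ring.
rewrite (bigD1 s0) //= [X in _ + X]big1 ?addr0 => [|s /negbTE ne]; last first.
  by rewrite big1 // => w _; rewrite ne mulr0.
by rewrite eqxx.
Qed.

(** A functional vanishing on the image defines elements of A_m, one for each relation, that are
    sent to 0 in V (x) A. They vanish by freeness, so the functional is zero on all of Q^* (x)
    U_m. *)
Lemma rel_free_surj : rel_free -> forall m, surj f m.
Proof.
move=> rf m; apply/surjP/subvP=> t /mem_slices ht; apply: contraT => /separating_functional.
case=> l [l0 lt].
have ev0 s : eval x (fun w : word m => l (s, w)) = 0.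
  move: s; apply: rf => i; rewrite -eval_rel; apply: (pair_eval0 qa) => c hc.
  pose C : {ffun word m.+2 -> k^o} := [ffun w => if w.1 == i then c w.2 else 0].
  have hC : C \in slices 'I_n (perp f m.+1).
    apply/mem_VU=> i'; case: (eqVneq i' i) => [->|/negbTE ne].
      by apply: (inU_ext _ hc) => w; rewrite /slice ffunE eqxx.
    by apply: (inU_ext _ (@inU_const0 _ _ _ k^o f m.+1)) => w; rewrite /slice ffunE /= ne.
  have E := l0 _ (memv_img (linfun (@headmap k 'I_n 'I_r f m)) hC).
  apply: etrans E; rewrite [RHS]sum_pair.
  transitivity (\sum_s \sum_(w : word m) \sum_j l (s, w) * (f s i j * c (j, w))).
    rewrite sum_word.
    under [RHS]eq_bigr do rewrite exchange_big.
    rewrite [RHS]exchange_big; apply: eq_bigr => j _.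
    rewrite [RHS]exchange_big; apply: eq_bigr => w _.
    by rewrite mulr_suml; apply: eq_bigr => s _ /=; ring.
  apply: eq_bigr => s _; apply: eq_bigr => w _; rewrite lfunE /= ffunE /= -mulr_sumr.
  congr (_ * _); rewrite [RHS](bigD1 i) //= [X in _ + X]big1 ?addr0.
    by apply: eq_bigr => j _; rewrite ffunE eqxx.
  by move=> i' /negbTE ne; rewrite big1 // => j _; rewrite ffunE /= ne scaler0.
case/eqP: lt; rewrite sum_pair big1 // => s _.
apply: (eval0_pair qa (ev0 s) (c := fun w => t (s, w))).
by apply/mem_perp_fun/ht.
Qed.

End FewRelations.

(* Up to swapping letters, (f, H) and (G, Q) are dual bases of V (x) V and its
   dual. *)
Record dual_bases (k : fieldType) (n r : nat) (J : finType)
    (f G : 'I_r -> 'I_n -> 'I_n -> k) (Q H : J -> 'I_n -> 'I_n -> k) : Prop :=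
  DualBases {
  db_Qf : forall j s, \sum_a \sum_b Q j a b * f s b a = 0;
  db_id : forall a b a' b', ((a == a') && (b == b'))%:R
      = \sum_s f s a b * G s a' b' + \sum_j H j a b * Q j b' a';
  db_Gf : forall s s', \sum_a \sum_b G s a b * f s' a b = (s == s')%:R;
  db_QH : forall j j', \sum_a \sum_b Q j a b * H j' b a = (j == j')%:R
}.

(** * The criterion when W_3 vanishes *)

Section Criteria.
Variables (k : fieldType) (n r : nat) (A : cg_algebra k).
Variables (f G : 'I_r -> 'I_n -> 'I_n -> k) (x : 'I_n -> A).
Hypothesis qa : quad_alg_facts f x.
Variables (J : finType) (Q H : J -> 'I_n -> 'I_n -> k).
Hypothesis db : dual_bases f G Q H.
Local Notation word := (word 'I_n).
Local Notation inW := (inW Q).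
Local Notation kdiff := (kdiff x).
Local Notation exact_at := (exact_at x Q).

Lemma orth : orthogonal_rel f Q.
Proof. by split; [apply: db_Qf db | exists G, H; apply: db_id db]. Qed.

(** Identifies R (x) A with W_2 (x) A; the letters are swapped because words are stored from the
    end. *)
Definition rel_word (c : 'I_r -> A) (w : word 2) : A^o := \sum_s f s w.2.1 w.1 *: c s.

Lemma inW_rel_word c : inW (rel_word c).
Proof.
apply/inUSS; split=> [i|j []]; first exact: inU1.
transitivity (\sum_s (\sum_a \sum_b Q j a b * f s b a) *: c s : A); last first.
  by rewrite big1 // => s _; rewrite (db_Qf db) scale0r.
under [RHS]eq_bigr do rewrite scaler_suml; rewrite [RHS]exchange_big.
apply: eq_bigr => a _; under [RHS]eq_bigr do rewrite scaler_suml; rewrite [RHS]exchange_big.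
apply: eq_bigr => b _; rewrite scale_alg scaler_sumr.
by apply: eq_bigr => s _; rewrite scalerA.
Qed.

Lemma kdiff_rel_word c w :
  kdiff (rel_word c) w = \sum_s \sum_j f s w.1 j *: (x j * c s).
Proof.
rewrite exchange_big; apply: eq_bigr => j _.
rewrite -[LHS]/(_ * _) mulr_sumr; apply: eq_bigr => s _.
exact: esym (scalerAr _ _ _).
Qed.

Lemma rel_word_inj c : (forall w, rel_word c w = 0) -> forall s, c s = 0.
Proof.
move=> h s0.
transitivity (\sum_a \sum_b G s0 a b *: (rel_word c (b, (a, tt)) : A)); last first.
  by rewrite big1 // => a _; rewrite big1 // => b _; rewrite h scaler0.
transitivity (\sum_s (\sum_a \sum_b G s0 a b * f s a b) *: c s).
  rewrite (bigD1 s0) //= (db_Gf db) eqxx scale1r big1 ?addr0 // => s /negbTE ne.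
  by rewrite (db_Gf db) eq_sym ne scale0r.
under eq_bigr do rewrite scaler_suml; rewrite exchange_big.
apply: eq_bigr => a _; under eq_bigr do rewrite scaler_suml; rewrite exchange_big.
apply: eq_bigr => b _; rewrite scaler_sumr.
by apply: eq_bigr => s _; rewrite scalerA.
Qed.

Lemma inW_rel_wordP (z : word 2 -> A^o) : inW z ->
  exists c, forall w, z w = rel_word c w.
Proof.
move/(inW_rel (a := 0) orth tt) => [c Ec]; exists c => -[i [j []]]; rewrite Ec.
by apply: eq_bigr => s _; apply: scale_alg.
Qed.

Lemma exact_at0 : exact_at A^o 0.
Proof.
move=> z iz dz.
have [|u Eu] := qa_syz qa (y := fun i => z (i, tt)); first exact: (dz tt).
exists (rel_word u); split; first exact: inW_rel_word.
by case=> i []; rewrite kdiff_rel_word Eu.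
Qed.

Section FewRelations.
Hypothesis surj_1 : surj f 1.

(** By surjectivity there is a [C] in V (x) U_2 whose pairing with R V extracts one chosen
    coefficient. Being orthogonal to V R, it pairs to 0 with [z], which lies in both, so every
    coefficient of [z] is zero. *)
Lemma inW3_eq0 (z : word 3 -> A^o) : inW z -> forall w, z w = 0.
Proof.
move=> iz.
have /fin_all_exists[c Ec] := fun i => inW_rel_wordP (inU_slice i iz).
suff c0 i s : c i s = 0.
  by case=> i w; rewrite [z _]Ec /rel_word big1 // => s _; rewrite c0 scaler0.
have /fin_all_exists[c' Ec'] : forall i1, exists c : 'I_r -> A^o, forall i j,
    z (i, (j, (i1, tt))) = \sum_s (f s j i)%:A *: c s.
  by move=> i1; apply: (inW_rel (a := 1) orth _ iz).
have [|C [hC EC]] := @surj_1 (fun s' (w : word 1) => if (s == s') && (i == w.1) then 1 else 0).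
  by move=> s'; apply: inU1.
transitivity (\sum_i1 \sum_i2 \sum_i3 C i1 (i2, (i3, tt)) *: (z (i3, (i2, (i1, tt))) : A)).
  transitivity (\sum_i3 \sum_s' (if (s == s') && (i == i3) then 1 else 0 : k) *: c i3 s').
    rewrite (bigD1 i) //= (bigD1 s) //= !eqxx scale1r.
    rewrite [X in _ + X + _]big1 ?addr0 => [|s' /negbTE ne]; last first.
      by rewrite eq_sym ne scale0r.
    rewrite big1 ?addr0 // => i3 /negbTE ne; rewrite big1 // => s' _.
    by rewrite [i == i3]eq_sym ne andbF scale0r.
  under [RHS]eq_bigr do rewrite exchange_big; rewrite [RHS]exchange_big.
  apply: eq_bigr => i3 _.
  transitivity (\sum_s' (\sum_i1 \sum_i2 f s' i1 i2 * C i1 (i2, (i3, tt))) *: c i3 s').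
    by apply: eq_bigr => s' _; rewrite -(EC s' (i3, tt)).
  under [LHS]eq_bigr do rewrite scaler_suml; rewrite [LHS] exchange_big.
  apply: eq_bigr => i1 _; under [LHS]eq_bigr do rewrite scaler_suml; rewrite [LHS] exchange_big.
  apply: eq_bigr => i2 _; rewrite [z _](Ec i3 (i2, (i1, tt))) /rel_word scaler_sumr.
  by apply: eq_bigr => s' _; rewrite scalerA mulrC.
rewrite big1 // => i1 _.
have /inUSS[_ h] := hC i1.
transitivity (\sum_s' (\sum_i2 \sum_i3 f s' i2 i3 * C i1 (i2, (i3, tt))) *: (c' i1 s' : A)).
  under [RHS]eq_bigr do rewrite scaler_suml; rewrite [RHS]exchange_big.
  apply: eq_bigr => i2 _; under [RHS]eq_bigr do rewrite scaler_suml; rewrite [RHS]exchange_big.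
  apply: eq_bigr => i3 _; rewrite Ec' scaler_sumr.
  by apply: eq_bigr => s' _; rewrite scale_alg scalerA mulrC.
rewrite big1 // => s' _; have E := h s' tt.
by rewrite (_ : \sum_i2 _ = 0) ?scale0r //; exact: E.
Qed.

Lemma inW_ge3_eq0 a (z : word a.+3 -> A^o) : inW z -> forall w, z w = 0.
Proof.
elim: a z => [|a IH] z iz; first exact: inW3_eq0.
by case=> i w; apply: (IH (slice z i)); apply: inU_slice.
Qed.

Lemma exact_rel_free : exact_at A^o 1 -> rel_free f x.
Proof.
move=> ex u Eu; apply: rel_word_inj => w.
have [|y [iy <-]] := ex (rel_word u) (inW_rel_word u).
  by move=> w'; rewrite kdiff_rel_word Eu.
by rewrite /kdiff big1 // => i _; rewrite (inW3_eq0 iy) scaler0.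
Qed.

Lemma rel_free_exact : rel_free f x -> forall a, exact_at A^o a.
Proof.
move=> rf [|[|a]]; first exact: exact_at0.
  move=> z iz dz; have [c Ec] := inW_rel_wordP iz.
  have c0 : forall s, c s = 0.
    apply: rf => i; apply: etrans (dz (i, tt)); rewrite (kdiff_ext _ _ Ec).
    by rewrite kdiff_rel_word.
  exists (fun=> 0); split=> [|w]; first exact: inW0.
  by rewrite kdiff_0 Ec /rel_word big1 // => s _; rewrite c0 scaler0.
move=> z iz dz; exists (fun=> 0); split=> [|w]; first exact: inW0.
by rewrite kdiff_0 (inW_ge3_eq0 iz).
Qed.

Lemma koszul_few : koszul A <-> forall m, surj f m.
Proof.
split=> [ks m|sf].
  by apply: (rel_free_surj qa); apply: exact_rel_free; apply: (koszul_exact qa orth).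
by apply: (exact_koszul qa orth); apply/rel_free_exact/(surj_rel_free qa).
Qed.

End FewRelations.
End Criteria.

(** * The criterion when A_3 vanishes *)

Section ManyRelations.
Variables (k : fieldType) (n r : nat) (A : cg_algebra k).
Variables (f G : 'I_r -> 'I_n -> 'I_n -> k) (x : 'I_n -> A).
Hypothesis qa : quad_alg_facts f x.
Variables (J : finType) (Q H : J -> 'I_n -> 'I_n -> k).
Hypothesis db : dual_bases f G Q H.
Local Notation word := (word 'I_n).
Local Notation inW := (inW Q).
Local Notation kdiff := (kdiff x).
Local Notation exact_at := (exact_at x Q).
Let orthQ := orth db.

(** The basis of A_2 = V (x) V / R dual to [Q]; in it the products x_a x_b have the entries of [Q]
    as coordinates. *)
Definition quad_basis j : A := \sum_a \sum_b H j a b *: (x a * x b).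

Lemma quad_basisE a b : x a * x b = \sum_j Q j b a *: quad_basis j.
Proof.
transitivity (\sum_a' \sum_b' ((a' == a) && (b' == b))%:R *: (x a' * x b')).
  rewrite (bigD1 a) //= (bigD1 b) //= !eqxx scale1r.
  rewrite [X in _ + X + _]big1 ?addr0 => [|b' /negbTE ->]; last by rewrite scale0r.
  rewrite big1 ?addr0 // => a' /negbTE ->; rewrite big1 // => b' _.
  by rewrite scale0r.
under eq_bigr do under eq_bigr do rewrite (db_id db) scalerDl.
under eq_bigr do rewrite big_split; rewrite big_split /=.
rewrite [X in X + _](_ : _ = 0) ?add0r.
  under [RHS]eq_bigr do rewrite scaler_sumr; rewrite [RHS]exchange_big.
  apply: eq_bigr => a' _; under [RHS]eq_bigr do rewrite scaler_sumr.
  rewrite [RHS]exchange_big; apply: eq_bigr => b' _; rewrite scaler_suml.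
  by apply: eq_bigr => j _; rewrite scalerA mulrC.
transitivity (\sum_s G s a b *: \sum_a' \sum_b' f s a' b' *: (x a' * x b')).
  under [RHS]eq_bigr do rewrite scaler_sumr; rewrite [RHS]exchange_big.
  apply: eq_bigr => a' _; under [RHS]eq_bigr do rewrite scaler_sumr.
  rewrite [RHS]exchange_big; apply: eq_bigr => b' _; rewrite scaler_suml.
  by apply: eq_bigr => s _; rewrite scalerA mulrC.
by rewrite big1 // => s _; rewrite (qa_rel qa) scaler0.
Qed.

Lemma quad_basis_indep (c : J -> k) :
  \sum_j c j *: quad_basis j = 0 -> forall j, c j = 0.
Proof.
move=> E j.
have [|d Ed] := quad_indep qa (t := fun a b => \sum_i c i * H i a b).
  apply: etrans E; under [RHS]eq_bigr do rewrite scaler_sumr.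
  rewrite [RHS]exchange_big; apply: eq_bigr => a _.
  under [RHS]eq_bigr do rewrite scaler_sumr; rewrite [RHS]exchange_big.
  apply: eq_bigr => b _; rewrite scaler_suml.
  by apply: eq_bigr => i _; rewrite scalerA.
transitivity (\sum_a \sum_b Q j a b * \sum_i c i * H i b a).
  transitivity (\sum_i c i * \sum_a \sum_b Q j a b * H i b a).
    rewrite (bigD1 j) //= (db_QH db) eqxx mulr1 big1 ?addr0 // => i /negbTE ne.
    by rewrite (db_QH db) eq_sym ne mulr0.
  under eq_bigr do rewrite mulr_sumr; rewrite exchange_big; apply: eq_bigr => a _.
  under eq_bigr do rewrite mulr_sumr; rewrite exchange_big; apply: eq_bigr => b _.
  by rewrite mulr_sumr; apply: eq_bigr => i _; rewrite mulrCA.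
transitivity (\sum_s d s * \sum_a \sum_b Q j a b * f s b a); last first.
  by rewrite big1 // => s _; rewrite (db_Qf db) mulr0.
under [RHS]eq_bigr do rewrite mulr_sumr; rewrite [RHS]exchange_big; apply: eq_bigr => a _.
under [RHS]eq_bigr do rewrite mulr_sumr; rewrite [RHS]exchange_big; apply: eq_bigr => b _.
by rewrite Ed mulr_sumr; apply: eq_bigr => s _; rewrite mulrCA.
Qed.

Lemma quad_basis_hom j : cg_hom 2 (quad_basis j).
Proof.
apply: hom_sum => a _; apply: hom_sum => b _; apply: homZ.
exact: (@cg_homM _ A 1 1) (qa_hom qa a) (qa_hom qa b).
Qed.

Lemma quad_basis_span (a : A) : cg_hom 2 a -> exists c, a = \sum_j c j *: quad_basis j.
Proof.
case/(hom_gen qa)=> y [hy ->].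
have /fin_all_exists[t Et] := fun i => x_comb qa (hy i).
exists (fun j => \sum_a \sum_b t a b * Q j b a).
under [RHS]eq_bigr do rewrite scaler_suml; rewrite [RHS]exchange_big.
apply: eq_bigr => i _; rewrite Et mulr_sumr.
under [RHS]eq_bigr do rewrite scaler_suml; rewrite [RHS]exchange_big.
apply: eq_bigr => b _; rewrite -scalerAr quad_basisE scaler_sumr.
by apply: eq_bigr => j _; rewrite scalerA.
Qed.

(* kdiff in degree 1 is the map whose surjectivity defines surj Q m. *)
Lemma kdiff_deg1 m (C : 'I_n -> word m.+1 -> k^o) w :
  kdiff (fun w' => \sum_i C i w' *: x i : A^o) w
  = \sum_j (\sum_a \sum_b Q j a b *: C a (b, w)) *: quad_basis j.
Proof.
under [RHS]eq_bigr do rewrite scaler_suml; rewrite [RHS]exchange_big.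
under [RHS]eq_bigr do under eq_bigr do rewrite scaler_suml.
under [RHS]eq_bigr do rewrite exchange_big; rewrite [RHS]exchange_big.
apply: eq_bigr => b _; rewrite -[LHS]/(_ * _) mulr_sumr; apply: eq_bigr => a _.
rewrite -scalerAr quad_basisE scaler_sumr; apply: eq_bigr => j _.
by rewrite scalerA mulrC.
Qed.

Lemma surj_lift m (z : word m -> A^o) : surj Q m ->
  (forall w, cg_hom 2 (z w)) -> inW z ->
  exists y : word m.+1 -> A^o, inW y /\ forall w, kdiff y w = z w.
Proof.
move=> sQ hz iz.
have /fin_all_exists[c Ec] := fun w => quad_basis_span (hz w).
have [|C [hC EC]] := sQ (fun j w => c w j).
  apply: (inW_comb_indep quad_basis_indep (t := c)).
  by apply: inW_ext iz => w; rewrite Ec.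
exists (fun w' => \sum_i C i w' *: x i); split.
  exact: (inW_comb x (t := fun w i => C i w)).
by move=> w; rewrite kdiff_deg1 Ec; apply: eq_bigr => j _; rewrite EC.
Qed.

(** A_3 is the image of W_1 (x) A_2, which in turn is the image of W_2 (x) A_1, and [kdiff] squares
    to zero. *)
Lemma surj_hom3_eq0 : surj Q 1 -> forall m (a : A), (2 < m)%N -> cg_hom m a -> a = 0.
Proof.
move=> sQ m a m2 ha.
have A3 (b : A) : cg_hom 3 b -> b = 0.
  case/(hom_gen qa)=> y [hy ->].
  have [||z [iz Ez]] := surj_lift (z := fun w : word 1 => y w.1) sQ; [by [] | exact: inU1 |].
  by apply: etrans (kdiff_kdiff (a := 0) qa orthQ tt iz); rewrite (kdiff_ext _ _ Ez).
elim: m m2 a ha => // -[//|[//|[|m]]] IH _ a ha; first exact: A3.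
have [y [hy ->]] := hom_gen qa ha.
by rewrite big1 // => i _; rewrite (IH isT _ (hy i)) mulr0.
Qed.

(** Exactness holds for coefficients of degree 0 and 1 in any case and is void from degree 3 on;
    what remains, in degree 2, is the surjectivity. *)
Lemma koszul_many : surj Q 1 -> koszul A <-> forall m, surj Q m.
Proof.
move=> sQ1; split=> [/(koszul_exact qa orthQ) ex m t ht|sQ]; last first.
  apply: (exact_koszul qa orthQ) => a; apply: (exact_graded qa) => -[|[|[|e]]].
  - exact: (exact_deg0 qa).
  - exact: (exact_deg1 qa orthQ).
  - by move=> z hz iz _; apply: surj_lift.
  move=> z hz iz _; exists (fun=> 0); split=> [|w]; first exact: inW0.
  by rewrite kdiff_0 (surj_hom3_eq0 sQ1 _ (hz w)).
pose z w : A^o := \sum_j t j w *: quad_basis j.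
have hz w : cg_hom 2 (z w) by apply: hom_sum => j _; apply/homZ/quad_basis_hom.
have iz : inW z by apply: (inW_comb quad_basis (t := fun w j => t j w)).
have [y0 [iy0 Ey0]] : exists y0 : word m.+1 -> A^o, inW y0 /\ forall w, kdiff y0 w = z w.
  (* For m = 0 no Koszul term precedes and A_2 = V A_1 is used; for larger m, [z] is a cycle because
     A_3 = 0. *)
  case: m t ht z hz iz => [|m] t ht z hz iz.
    have [y [_ Ey]] := hom_gen qa (hz tt).
    by exists (fun w : word 1 => y w.1); split=> [|[]]; [exact: inU1 | rewrite [RHS]Ey].
  apply: ex => // w; apply: (surj_hom3_eq0 sQ1 (m := 3)) => //.
  by apply: hom_sum => i _; apply: (@cg_homM _ A 1 2) (qa_hom qa i) (hz _).
have iy : inW (fun w => hcomp 1 (y0 w : A) : A^o).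
  by apply: (inW_map (phi := hcomp 1 : {additive A^o -> A^o})) iy0 => c p; apply: hcomp_alg.
have Ey w : kdiff (fun w => hcomp 1 (y0 w : A) : A^o) w = z w.
  rewrite -[RHS](hcomp_id (hz w)) -Ey0.
  exact: esym (hcomp_gen qa 1 (fun i => y0 (i, w))).
have /fin_all_exists[c Ec] := fun w => x_comb qa (hcomp_hom 1 (y0 w)).
exists (fun i w => c w i); split.
  apply: (inW_comb_indep (x_indep qa) (t := c)).
  by apply: inW_ext iy => w; rewrite Ec.
move=> j w; apply/eqP; rewrite -subr_eq0; apply/eqP; move: j.
apply: quad_basis_indep; under eq_bigr do rewrite scalerBl.
rewrite sumrB -(kdiff_deg1 (fun i w => c w i)) -[X in _ - X]Ey.
rewrite (kdiff_ext _ _ (z' := fun w => hcomp 1 (y0 w : A) : A^o)) ?subrr //.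
Qed.

End ManyRelations.

(** * The main theorem *)

Lemma row_free_complete (k : fieldType) (r q N : nat) (C : 'M[k]_(r, N)) :
  row_free C -> (r + q)%N = N ->
  exists (D : 'M_(q, N)) (B1 : 'M_(N, r)) (B2 : 'M_(N, q)),
  [/\ B1 *m C + B2 *m D = 1%:M, C *m B1 = 1%:M, C *m B2 = 0 & D *m B2 = 1%:M].
Proof.
move=> rC eN.
have [D ED] : exists D : 'M_(q, N), (D :=: C^C)%MS.
  have <- : \rank C^C%MS = q by rewrite mxrank_compl (eqP rC) -eN addKn.
  by exists (row_base C^C%MS); apply: eq_row_base.
pose M := col_mx C D.
have fM : row_full M.
  have h : (1%:M <= C + D)%MS.
    by rewrite (adds_eqmx (eqmx_refl C) ED) sub1mx addsmx_compl_full.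
  by rewrite -sub1mx; apply: submx_trans h _; rewrite addsmxE.
have rM : row_free M by rewrite /row_free (eqP fM) eN.
have /row_fullP[B EB] := fM.
have EM : M *m B = 1%:M.
  by apply: (row_free_inj rM); rewrite -mulmxA EB mulmx1 mul1mx.
exists D, (lsubmx B), (rsubmx B).
have E : M *m row_mx (lsubmx B) (rsubmx B) = 1%:M by rewrite hsubmxK.
rewrite mul_col_row scalar_mx_block in E; have [E1 E2 _ E4] := eq_block_mx E.
by split=> //; rewrite -mul_row_col hsubmxK.
Qed.

(** [f] is completed to a basis of V (x) V by [H], and [G] and [Q] are read off from the inverse
    matrix. *)
Lemma exists_dual_bases (k : fieldType) (n r q : nat) (f : 'I_r -> 'I_n -> 'I_n -> k) :
  (forall c : 'I_r -> k, (forall a b, \sum_s c s * f s a b = 0) -> forall s, c s = 0) ->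
  (r + q = n ^ 2)%N ->
  exists G (Q H : 'I_q -> 'I_n -> 'I_n -> k), dual_bases f G Q H.
Proof.
move=> ind eN; pose N := #|{: 'I_n * 'I_n}|; pose e a b : 'I_N := enum_rank (a, b).
pose C := \matrix_(s < r, p < N) f s (enum_val p).1 (enum_val p).2.
have CE s a b : C s (e a b) = f s a b by rewrite mxE enum_rankK.
have sumE (F : 'I_N -> k) : \sum_p F p = \sum_a \sum_b F (e a b).
  by rewrite (reindex _ (onW_bij _ (enum_rank_bij _))) sum_pair.
have rC : row_free C.
  apply/inj_row_free => v vC; apply/rowP => s; rewrite !mxE; move: s; apply: ind => a b.
  have /rowP/(_ (e a b)) := vC; rewrite !mxE => E; apply: etrans E.
  by apply: eq_bigr => s _; rewrite CE.
have [|D [B1 [B2 [E1 E2 E3 E4]]]] := row_free_complete (q := q) rC.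
  by rewrite eN /N card_prod card_ord mulnn.
exists (fun s a b => B1 (e a b) s), (fun j a b => B2 (e b a) j), (fun j a b => D j (e a b)).
split.
- move=> j s; have /matrixP/(_ s j) := E3; rewrite !mxE sumE => E; apply: etrans E.
  rewrite exchange_big; apply: eq_bigr => a _; apply: eq_bigr => b _.
  by rewrite CE mulrC.
- move=> a b a' b'; have /matrixP/(_ (e a' b') (e a b)) := E1; rewrite !mxE.
  have -> : (e a' b' == e a b) = (a == a') && (b == b').
    by rewrite (inj_eq enum_rank_inj) eq_sym.
  move=> <-; congr (_ + _); apply: eq_bigr => i _; rewrite mulrC // CE //.
- move=> s s'; have /matrixP/(_ s' s) := E2; rewrite !mxE sumE eq_sym => <-.
  by apply: eq_bigr => a _; apply: eq_bigr => b _; rewrite CE mulrC.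
- move=> j j'; have /matrixP/(_ j' j) := E4; rewrite !mxE sumE eq_sym => <-.
  by rewrite exchange_big; apply: eq_bigr => a _; apply: eq_bigr => b _; rewrite mulrC.
Qed.

Lemma dual_bases_span (k : fieldType) (n r : nat) (J : finType)
    (f G : 'I_r -> 'I_n -> 'I_n -> k) (Q H : J -> 'I_n -> 'I_n -> k)
    (t : 'I_n -> 'I_n -> k) :
  dual_bases f G Q H -> (forall s, \sum_a \sum_b f s b a * t a b = 0) ->
  forall a b, t a b = \sum_j (\sum_c \sum_d H j c d * t d c) * Q j a b.
Proof.
move=> db ht a b.
transitivity (\sum_c \sum_d ((c == b) && (d == a))%:R * t d c).
  rewrite (bigD1 b) //= (bigD1 a) //= !eqxx mul1r.
  rewrite [X in _ + X + _]big1 ?addr0 => [|d /negbTE ->]; last by rewrite mul0r.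
  by rewrite big1 ?addr0 // => c /negbTE ->; rewrite big1 // => d _; rewrite mul0r.
under eq_bigr do under eq_bigr do rewrite (db_id db) mulrDl.
under eq_bigr do rewrite big_split; rewrite big_split /=.
rewrite [X in X + _](_ : _ = 0) ?add0r.
  under [RHS]eq_bigr do rewrite mulr_suml; rewrite [RHS]exchange_big.
  apply: eq_bigr => c _; under [RHS]eq_bigr do rewrite mulr_suml.
  rewrite [RHS]exchange_big; apply: eq_bigr => d _; rewrite mulr_suml.
  by apply: eq_bigr => j _; rewrite mulrAC.
transitivity (\sum_s G s b a * \sum_d \sum_c f s c d * t d c); last first.
  by rewrite big1 // => s _; rewrite ht mulr0.
under [RHS]eq_bigr do rewrite exchange_big mulr_sumr; rewrite [RHS]exchange_big.
apply: eq_bigr => c _; under [RHS]eq_bigr do rewrite mulr_sumr.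
rewrite [RHS]exchange_big; apply: eq_bigr => d _; rewrite mulr_suml.
by apply: eq_bigr => s _; rewrite mulrA; congr (_ * _); rewrite mulrC.
Qed.

Lemma surj_card_le (k : fieldType) (n q : nat) (Q : 'I_q -> 'I_n -> 'I_n -> k) :
  (forall m, surj Q m) -> (4 * q <= n ^ 2)%N.
Proof.
move=> sQ; apply: (@linear_recurrence_pos n q (fun m => \dim (perp Q m))).
- exact: dim_perp0.
- by rewrite dim_perp1 card_ord.
move=> m; apply/eqP; rewrite eqn_leq.
by have := (surj_dimP Q m).1 (sQ m); have := dim_perp_ge Q m; rewrite !card_ord => -> ->.
Qed.

Lemma surj_generic (k F : fieldType) (n q : nat) (Q : 'I_q -> 'I_n -> 'I_n -> k) :
  (0 < n)%N ->
  (forall (T : 'I_q -> 'I_n -> 'I_n -> F) m, \dim (perp Q m) <= \dim (perp T m))%N ->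
  ((2 * q <= n ^ 2)%N -> surj Q 1) /\ ((4 * q <= n ^ 2)%N -> forall m, surj Q m).
Proof.
move=> n0 le; split=> [/(exists_surj1 F)[T hT]|/(exists_surj F)[T hT] m].
  apply: (surj_transfer (le T) (M := 2)) => // -[_|[_|//]].
    exact: surj1_surj0 (Ordinal n0) hT.
  exact: surj1_surj.
by apply: (surj_transfer (le T) (M := m.+1)).
Qed.

Lemma quadratic_presentation_indep (k : fieldType) (n r : nat) (A : cg_algebra k)
    (f : 'I_r -> free_algebra k n) : quadratic_presentation A f ->
  forall c : 'I_r -> k, (forall a b, \sum_s c s * quad_coeff (f s) a b = 0) ->
  forall s, c s = 0.
Proof.
move=> [hf ind _] c hc; apply: ind; apply/malgP=> w; rewrite mcoeff0 raddf_sum /=.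
under eq_bigr do rewrite mcoeffZ.
have [w2|w2] := eqVneq (fdeg w) 2%N; last first.
  by rewrite big1 // => s _; rewrite (free_homog2_out (hf s)) ?mulr0.
case: (fmonomP w) w2 => [->|[a [v ->]]]; first by rewrite fdeg1.
case: (fmonomP v) => [->|[b [u ->]]]; first by rewrite mulm1 fdegU.
rewrite !fdegM !fdegU => -[/fdeg_eq0I ->]; rewrite mulm1; exact: hc.
Qed.

Import Order.TTheory Num.Theory.

Theorem theorem4p3 (k : fieldType) (n r : nat) (A : cg_algebra k)
    (hn : (1 <= n)%N) (hr : (r <= n ^ 2)%N)
    (hA : strictly_generic n r A) :
  koszul A <->
  ((r%:R <= (n ^ 2)%:R / 4%:R :> rat)%R \/
   (3%:R * (n ^ 2)%:R / 4%:R <= r%:R :> rat)%R).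
Proof.
have [f0 [pres gen]] := hA; pose f s := quad_coeff (f0 s).
have [hf _ hpres] := pres; have [x qa] := presentation_facts hf hpres.
pose q := (n ^ 2 - r)%N; have eN : (r + q = n ^ 2)%N by rewrite subnKC.
have [G [Q [H db]]] := exists_dual_bases (quadratic_presentation_indep pres) eN.
have [few1 few] := surj_generic hn (fun T m => generic_dim_Uv (f := f) gen T m).
have [many1 many] :
  ((2 * q <= n ^ 2)%N -> surj Q 1) /\ ((4 * q <= n ^ 2)%N -> forall m, surj Q m).
  apply: (surj_generic (F := prime_subfield k) hn) => T m.
  have [J [Qa [hQa le]]] := generic_annihilator (f := f) gen T eN.
  (* The family [Qa] depends on [T], but it always lies in the span of the fixed basis [Q] of the
     orthogonal. *)
  apply: leq_trans (le m); apply: dim_perp_span => j a b.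
  by apply: (dual_bases_span db) => s; apply: hQa.
have -> : (r%:R <= (n ^ 2)%:R / 4%:R :> rat) = (4 * r <= n ^ 2)%N.
  by rewrite ler_pdivlMr // -natrM ler_nat mulnC.
have -> : (3%:R * (n ^ 2)%:R / 4%:R <= r%:R :> rat) = (4 * q <= n ^ 2)%N.
  rewrite ler_pdivrMr // -!natrM ler_nat /q.
  by clear -hr; apply/idP/idP; lia.
split=> [ks|[le|le]].
(* As r + q = n^2, one of r and q is at most n^2/2, so that genericity supplies the degree 3
   hypothesis of one of the two criteria. *)
- have [le|lt] := leqP (2 * r) (n ^ 2).
    by left; apply: surj_card_le; apply/(koszul_few qa db (few1 le)).
  by right; apply: surj_card_le; apply/(koszul_many qa db) => //; apply: many1; lia.
- by apply/(koszul_few qa db); [apply: few1; lia | apply: few].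
- by apply/(koszul_many qa db); [apply: many1; lia | apply: many].
Qed.
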